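(* Consider the unconstrained nonconvex multi-agent problem and the Zeroth-order Feedback Optimization (ZFO) algorithm described in the context. Suppose $\sigma>0$ (noisy observations), and let $\epsilon>0$ be sufficiently small. If the algorithm's parameters satisfy $$u\leq\frac{\sqrt{\epsilon}}{4L\sqrt{d}},\qquad \eta\leq\frac{\epsilon u^2/\sigma^2}{2L\bar b\sqrt{n}\,d},\qquad T-B+1\geq\left\lceil\frac{6}{\eta\epsilon}\max\{f(x(0))-f^\ast,1\}\right\rceil,$$ then $$\frac{1}{T-B+1}\sum_{t=B}^{T}\mathbb{E}\left[\|\nabla f(x(t))\|^2\right]\leq\epsilon .$$ Moreover, if all the conditions on the parameters are satisfied with equality, then $T=\Theta\left(\dfrac{\bar b\sqrt{n}\,d^2}{\epsilon^3}\right)$.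
   Context: Problem (unconstrained nonconvex setting). There are $n$ agents; agent $i$ has an action $x^i\in\mathbb{R}^{d_i}$, $d=\sum_id_i$, $x=(x^1,\ldots,x^n)\in\mathbb{R}^d$. Each local cost $f_i:\mathbb{R}^d\to\mathbb{R}$ is $G$-Lipschitz and $L$-smooth ($|f_i(x)-f_i(y)|\le G\|x-y\|$, $\|\nabla f_i(x)-\nabla f_i(y)\|\le L\|x-y\|$, $\ell_2$ norms). The objective is $f=\frac1n\sum_{i=1}^nf_i$, possibly nonconvex, and $f^\ast=\inf_{x\in\mathbb{R}^d}f(x)>-\infty$. ZFO algorithm (unconstrained). Parameters: step size $\eta>0$, smoothing radius $u>0$, number of iterations $T\ge B$, an initial action profile $x(0)\in\mathbb{R}^d$. The agents are joined by a communication network, a connected undirected graph on $\{1,\ldots,n\}$; $b_{ij}$ is the graph distance between $i$ and $j$. At each time $t=0,1,2,\ldots$: (1) each agent $i$ draws $z^i(t)\sim\mathcal{N}(0,I_{d_i})$, afresh at each time and independently across agents; $z(t)=(z^1(t),\ldots,z^n(t))$; (2) agent $i$ observes $\hat f_i^\pm(t)=f_i(x(t)\pm uz(t))+\varepsilon_i^\pm(t)$ and computes $D_i(t)=\frac{\hat f_i^+(t)-\hat f_i^-(t)}{2u}$; the noises $\varepsilon_i^\pm(t)$ have zero mean and variance at most $\sigma^2$, and are independent of each other and of the action profile; (3) agent $i$ keeps for every $j$ a pair $(D^i_j(t),\tau^i_j(t))$, initialised as $(0,-1)$ at time $-1$. It sets $D^i_i(t)=D_i(t)$, $\tau^i_i(t)=t$;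 for $j\ne i$ it adopts, among the pairs concerning $j$ received at time $t$ from its neighbours (its own previous pair standing in for a neighbour from which nothing arrives), the one with the largest time stamp; it then sends all its pairs to its neighbours. Thus $D^i_j(t)=D_j(\tau^i_j(t))$, with the convention $D_j(s)=0$, $z(s)=0$ for $s<0$. It forms $G^i(t)=\frac1n\sum_{j=1}^nD^i_j(t)\,z^i(\tau^i_j(t))$; $G(t)=(G^1(t),\ldots,G^n(t))$; (4) $x(t+1)=x(t)-\eta G(t)$. Delays. There is $\Delta\ge0$ with $t-\tau^i_j(t)\le b_{ij}+\Delta$ for all $t\ge0$ and all $i,j$. Define $$\bar b=\left(\frac{\sum_{i,j=1}^n(b_{ij}+\Delta)^2}{n^2}\right)^{1/2},\qquad B=\max_{i,j}b_{ij}+\Delta .$$ *)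

(* Defs.v *)
From HB Require Import structures.
From mathcomp Require Export all_boot all_order all_algebra.
From mathcomp Require Export all_classical all_reals all_analysis.

Set Implicit Arguments.
Unset Strict Implicit.
Unset Printing Implicit Defensive.

Export Order.TTheory GRing.Theory Num.Theory.
Export numFieldNormedType.Exports.

Global Open Scope classical_set_scope.
Global Open Scope ring_scope.

(* The library norm on row vectors is the sup norm, hence [norm2]. *)
Definition norm2 {R : realType} {m : nat} (x : 'rV[R]_m) : R :=
  Num.sqrt (\sum_k x ord0 k ^+ 2).

Definition gradient {R : realType} {m : nat} (f : 'rV[R]_m -> R)
    (x : 'rV[R]_m) : 'rV[R]_m :=
  \row_k 'D_(delta_mx ord0 k) f x.

Definition lipschitz2 {R : realType} {m : nat} (G : R) (f : 'rV[R]_m -> R) :=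
  forall x y, `|f x - f y| <= G * norm2 (x - y).

Definition smooth2 {R : realType} {m : nat} (L : R) (f : 'rV[R]_m -> R) :=
  (forall x, differentiable f x) /\
  (forall x y, norm2 (gradient f x - gradient f y) <= L * norm2 (x - y)).

(* x = (x^1, ..., x^n) with x^i = submxrow x i in 'rV_(dim i). *)
Notation profile R dim := 'rV[R]_(\sum_i dim i).

Definition objective {R : realType} {n : nat} {dim : 'I_n -> nat}
    (f : 'I_n -> profile R dim -> R) (x : profile R dim) : R :=
  n%:R^-1 * \sum_i f i x.

Definition infimum {R : realType} {m : nat} (f : 'rV[R]_m -> R) : R :=
  inf (range f).

(* In a connected graph on n vertices every distance is less than n, so the
   search always succeeds. *)
Definition gdist {n : nat} (e : rel 'I_n) (i j : 'I_n) : nat :=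
  find (fun k => [exists p : k.-tuple 'I_n, path e i p && (last i p == j)])
       (iota 0 n).

Definition connected_graph {n : nat} (e : rel 'I_n) : Prop :=
  [/\ symmetric e, irreflexive e & forall i j, connect e i j].

Definition avg_delay (R : realType) {n : nat} (e : rel 'I_n) (Delta : nat) : R :=
  Num.sqrt ((\sum_i \sum_j (gdist e i j + Delta)%:R ^+ 2) / n%:R ^+ 2).

Definition max_delay {n : nat} (e : rel 'I_n) (Delta : nat) : nat :=
  (\max_i \max_j gdist e i j + Delta)%N.

Section protocol.
Context {R : realType} {n : nat} (dim : 'I_n -> nat).

(* [tab t i j] is the pair (D^i_j(t), tau^i_j(t)) held by agent i. *)
Definition table := nat -> 'I_n -> 'I_n -> R * int.

Definition previous_pair (tab : table) (t : nat) (i j : 'I_n) : R * int :=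
  if t is s.+1 then tab s i j else (0, -1).

(* [arr t i k] lists the sending times of the messages from agent k that reach
   agent i at time t; without losses or latency, arr t.+1 i k = [:: t]. *)
Definition candidate_pairs (e : rel 'I_n) (arr : nat -> 'I_n -> 'I_n -> seq nat)
    (tab : table) (t : nat) (i j : 'I_n) : seq (R * int) :=
  flatten [seq if arr t i k is [::] then [:: previous_pair tab t i j]
               else [seq tab s k j | s <- arr t i k]
          | k <- enum 'I_n & e i k].

Definition at_stamp {V : zmodType} (a : nat -> V) (s : int) : V :=
  if s is Posz t then a t else 0.

Definition stack (z : forall i : 'I_n, nat -> 'rV[R]_(dim i)) (t : nat)
    : profile R dim :=
  \mxrow_i z i t.

Definition observed_difference (f : 'I_n -> profile R dim -> R) (u : R)
    (z : forall i : 'I_n, nat -> 'rV[R]_(dim i)) (noiseP noiseM : 'I_n -> nat -> R)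
    (x : nat -> profile R dim) (i : 'I_n) (t : nat) : R :=
  ((f i (x t + u *: stack z t) + noiseP i t)
   - (f i (x t - u *: stack z t) + noiseM i t)) / (2 * u).

Definition local_estimate (z : forall i : 'I_n, nat -> 'rV[R]_(dim i))
    (tab : table) (t : nat) (i : 'I_n) : 'rV[R]_(dim i) :=
  n%:R^-1 *: \sum_j (tab t i j).1 *: at_stamp (z i) (tab t i j).2.

(* One realisation of the algorithm, for given perturbations, noises and
   message arrivals.  Ties between candidates with the same stamp are harmless:
   such pairs are equal. *)
Record zfo_run (e : rel 'I_n) (arr : nat -> 'I_n -> 'I_n -> seq nat)
    (f : 'I_n -> profile R dim -> R) (u eta : R) (x0 : profile R dim)
    (z : forall i : 'I_n, nat -> 'rV[R]_(dim i)) (noiseP noiseM : 'I_n -> nat -> R)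
    (x : nat -> profile R dim) (tab : table) : Prop := {
  run_init : x 0%N = x0;
  run_own : forall t i,
    tab t i i = (observed_difference f u z noiseP noiseM x i t, t%:Z);
  run_adopt : forall t i j, i != j ->
    tab t i j \in candidate_pairs e arr tab t i j /\
    (forall p, p \in candidate_pairs e arr tab t i j -> p.2 <= (tab t i j).2);
  run_step : forall t,
    x t.+1 = x t - eta *: \mxrow_i local_estimate z tab t i
}.

End protocol.

Definition mutually_independent {d : measure_display} {Omega : measurableType d}
    {R : realType} (P : probability Omega R) {I : eqType}
    (X : I -> {RV P >-> R}) : Prop :=
  forall (s : seq I) (A : I -> set R), uniq s -> (forall i, measurable (A i)) ->
    P (\bigcap_(i in [set i | i \in s]) (X i @^-1` A i)) =
    (\prod_(i <- s) P (X i @^-1` A i))%E.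

Section randomness.
Context {d : measure_display} {Omega : measurableType d} {R : realType}
  {P : probability Omega R} {n : nat} {dim : 'I_n -> nat}.

(* [z i t k] is the k-th coordinate of z^i(t). *)
Definition perturbation (z : forall i : 'I_n, nat -> 'I_(dim i) -> {RV P >-> R})
    (w : Omega) (i : 'I_n) (t : nat) : 'rV[R]_(dim i) :=
  \row_k z i t k w.

Definition primitive_variable
    (z : forall i : 'I_n, nat -> 'I_(dim i) -> {RV P >-> R})
    (noiseP noiseM : 'I_n -> nat -> {RV P >-> R})
    (a : nat * ({i : 'I_n & 'I_(dim i)} + ('I_n + 'I_n))) : {RV P >-> R} :=
  match a.2 with
  | inl ik => z (tag ik) a.1 (tagged ik)
  | inr (inl i) => noiseP i a.1
  | inr (inr i) => noiseM i a.1
  end.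

(* N(0, I_m) is the law of m independent standard normal coordinates. *)
Record zfo_randomness (z : forall i : 'I_n, nat -> 'I_(dim i) -> {RV P >-> R})
    (noiseP noiseM : 'I_n -> nat -> {RV P >-> R}) (sigma : R) : Prop := {
  rand_gaussian : forall i t k (A : set R), measurable A ->
    distribution P (z i t k) A = normal_prob 0 1 A;
  rand_meanP : forall i t, ('E_P[noiseP i t] = 0)%E;
  rand_meanM : forall i t, ('E_P[noiseM i t] = 0)%E;
  rand_varP : forall i t, ('V_P[noiseP i t] <= (sigma ^+ 2)%:E)%E;
  rand_varM : forall i t, ('V_P[noiseM i t] <= (sigma ^+ 2)%:E)%E;
  rand_indep : mutually_independent (primitive_variable z noiseP noiseM)
}.

End randomness.

Record problem {R : realType} {n : nat} {dim : 'I_n -> nat} (G L : R)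
    (f : 'I_n -> profile R dim -> R) : Prop := {
  cost_lipschitz : forall i, lipschitz2 G (f i);
  cost_smooth : forall i, smooth2 L (f i);
  objective_bounded : has_lbound (range (objective f))
}.

(* Main.v *)
From HB Require Import structures.
From mathcomp Require Import measurable_realfun ring lra zify.
Require Import Defs.

Set Implicit Arguments.
Unset Strict Implicit.
Unset Printing Implicit Defensive.

(** Work in flat coordinates: [Z t] stacks the perturbations drawn at time [t], and the
coordinate [k] of a step averages over [j] the samples [D_j(s) Z_k(s)] at the stale times
[s = tau_kj(t)], which do not depend on the randomness.  The iterate [X s] depends only
on the variables of times before [s].  Integrating one variable at a time against its own
law, the others being known, shows three things: the noise averages out; by Stein's
identity in the coordinate [k], the sample has the conditional mean of the average of the
partial derivatives of [f_j] at [X s + u Z s] and [X s - u Z s]; and there [Z s] may be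
exchanged for [Z t], so that the smoothing biases of all the coordinates refer to the same
point and add up to [L u sqrt D].  What remains is the descent lemma, with the drift
[X t - X s] and the squared step controlled by the second moment of a sample, which the
noise term [sigma^2 / (2 u^2)] dominates.  The initial gap, the smoothing bias, the
squared step, the delays and the lower-order drifts take the shares
[(1/6 + 1/8 + 127/800 + 127/400 + 1/100) eps < 7/8 eps]. *)

(** * Cauchy-Schwarz inequalities *)

Lemma psd_form_cross_le (R : rcfType) (a b c : R) :
  (forall s t : R, 0 <= s ^+ 2 * a + 2 * (s * t) * c + t ^+ 2 * b) ->
  `|c| <= Num.sqrt a * Num.sqrt b.
Proof.
move=> psd.
have a_ge0 : 0 <= a by have := psd 1 0; lra.
have b_ge0 : 0 <= b by have := psd 0 1; lra.
suff sqr_c_le : c ^+ 2 <= a * b by rewrite -sqrtrM// -sqrtr_sqr ler_wsqrtr.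
have [a_eq0|a_neq0] := eqVneq a 0.
  have := psd (b + 1) (- c); rewrite a_eq0 mul0r => ?.
  by have := sqr_ge0 c; have := mulr_ge0 b_ge0 (sqr_ge0 c); nra.
rewrite -subr_ge0 -(@pmulr_rge0 _ a) ?lt0r ?a_neq0//.
have := psd (- c) a; rewrite (_ : _ + _ + _ = a * (a * b - c ^+ 2))//; ring.
Qed.

Lemma cauchy_schwarz_sum (R : rcfType) (I : finType) (p : pred I) (a b : I -> R) :
  `|\sum_(i | p i) a i * b i| <=
  Num.sqrt (\sum_(i | p i) a i ^+ 2) * Num.sqrt (\sum_(i | p i) b i ^+ 2).
Proof.
apply: psd_form_cross_le => s t; rewrite !mulr_sumr -!big_split.
by apply: sumr_ge0 => i _ /=; have := sqr_ge0 (s * a i + t * b i); lra.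
Qed.

Lemma mean_le (R : numFieldType) (n : nat) (a : 'I_n -> R) (c : R) : 0 <= c ->
  (forall i, a i <= c) -> n%:R^-1 * \sum_i a i <= c.
Proof.
case: n a => [|n] a c_ge0 ac; first by rewrite big_ord0 mulr0.
rewrite ler_pdivrMl ?ltr0n// mulr_natl -[X in _ *+ X]card_ord -sumr_const.
exact: ler_sum.
Qed.

Lemma sqr_mean_le (R : rcfType) (n : nat) (a : 'I_n -> R) :
  (n%:R^-1 * \sum_j a j) ^+ 2 <= n%:R^-1 * \sum_j a j ^+ 2.
Proof.
case: n a => [|n] a; first by rewrite !big_ord0 !mulr0 expr0n.
have n_gt0 : 0 < n.+1%:R :> R by rewrite ltr0n.
rewrite exprMn expr2 -mulrA ler_pM2l ?invr_gt0// ler_pdivrMl//.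
have := @cauchy_schwarz_sum R 'I_n.+1 predT (fun=> 1) a.
rewrite (eq_bigr a) => [|i _]; last exact: mul1r.
rewrite expr1n sumr_const card_ord -sqrtrM// -sqrtr_sqr ler_psqrt ?nnegrE ?sqr_ge0//.
by rewrite mulr_ge0// sumr_ge0// => i _; exact: sqr_ge0.
Qed.

(** * Real-valued expectations *)

HB.lock Definition expect {d : measure_display} {Omega : measurableType d}
    {R : realType} (P : probability Omega R) (X : Omega -> R) : R :=
  \int[P]_w X w.

Section expectation.
Context {d : measure_display} {Omega : measurableType d} {R : realType}
  (P : probability Omega R).
Implicit Types X Y : Omega -> R.
Local Notation expect := (expect P).

Definition integrable_rv X := P.-integrable setT (EFin \o X).

Lemma integrable_rv_measurable X : integrable_rv X -> measurable_fun setT X.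
Proof. by move=> /measurable_int /measurable_EFinP. Qed.

Lemma EFin_expect X : integrable_rv X -> ((expect X)%:E = \int[P]_w (X w)%:E)%E.
Proof. by move=> iX; rewrite expect.unlock /Rintegral fineK// integrable_fin_num. Qed.

Lemma le_integrable_rv X Y : measurable_fun setT X -> (forall w, `|X w| <= Y w) ->
  integrable_rv Y -> integrable_rv X.
Proof.
move=> mX XY; apply: le_integrable => //; first exact/measurable_EFinP.
by move=> w _ /=; rewrite lee_fin (le_trans (XY w)) ?ler_norm.
Qed.

Lemma ge0_integrable_rv X (c : R) : measurable_fun setT X -> (forall w, 0 <= X w) ->
  (\int[P]_w (X w)%:E <= c%:E)%E -> integrable_rv X.
Proof.
move=> mX X0 Xc; apply/integrableP; split; first exact/measurable_EFinP.
under eq_integral do rewrite /= ger0_norm//.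
exact: le_lt_trans Xc (ltry _).
Qed.

Lemma integrable_rv_cst c : integrable_rv (fun=> c).
Proof. exact: finite_measure_integrable_cst. Qed.

Lemma integrable_rvD X Y :
  integrable_rv X -> integrable_rv Y -> integrable_rv (fun w => X w + Y w).
Proof. by move=> iX iY; have := integrableD measurableT iX iY. Qed.

Lemma integrable_rvB X Y :
  integrable_rv X -> integrable_rv Y -> integrable_rv (fun w => X w - Y w).
Proof. by move=> iX iY; have := integrableB measurableT iX iY. Qed.

Lemma integrable_rvZ c X : integrable_rv X -> integrable_rv (fun w => c * X w).
Proof. by move=> iX; have := integrableZl measurableT c iX. Qed.

Lemma integrable_rv_norm X : integrable_rv X -> integrable_rv (fun w => `|X w|).
Proof. by move=> iX; have := integrable_abse iX. Qed.

Lemma integrable_rv_sum (J : Type) (r : seq J) (p : pred J) (X : J -> Omega -> R) :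
  (forall j, p j -> integrable_rv (X j)) ->
  integrable_rv (fun w => \sum_(j <- r | p j) X j w).
Proof.
move=> iX; have := integrable_sum measurableT r iX.
by apply: eq_integrable => // w _; rewrite /= sumEFin.
Qed.

Lemma expect_cst c : expect (fun=> c) = c.
Proof.
rewrite expect.unlock Rintegral_cst// (_ : fine _ = 1) ?mulr1//.
exact: (congr1 fine (probability_setT P)).
Qed.

Lemma expectD X Y : integrable_rv X -> integrable_rv Y ->
  expect (fun w => X w + Y w) = expect X + expect Y.
Proof. by move=> iX iY; rewrite expect.unlock RintegralD. Qed.

Lemma expectB X Y : integrable_rv X -> integrable_rv Y ->
  expect (fun w => X w - Y w) = expect X - expect Y.
Proof. by move=> iX iY; rewrite expect.unlock RintegralB. Qed.

Lemma expectZ c X : integrable_rv X -> expect (fun w => c * X w) = c * expect X.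
Proof. by move=> iX; rewrite expect.unlock RintegralZl. Qed.

Lemma expect_sum (J : Type) (r : seq J) (p : pred J) (X : J -> Omega -> R) :
  (forall j, p j -> integrable_rv (X j)) ->
  expect (fun w => \sum_(j <- r | p j) X j w) = \sum_(j <- r | p j) expect (X j).
Proof.
move=> iX; elim: r => [|j r IH].
  under [X in expect X]eq_fun do rewrite big_nil.
  by rewrite big_nil expect_cst.
under [X in expect X]eq_fun do rewrite big_cons.
rewrite big_cons -IH; case: ifPn => // pj.
by rewrite -expectD//; [exact: iX|exact: integrable_rv_sum].
Qed.

Lemma expect_sum_le (J : finType) (p : pred J) (X : J -> Omega -> R) (c : R) :
  (forall j, p j -> integrable_rv (X j)) -> (forall j, p j -> expect (X j) <= c) ->
  expect (fun w => \sum_(j | p j) X j w) <= #|p|%:R * c.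
Proof.
move=> iX Xc; by rewrite expect_sum// mulr_natl -sumr_const; exact: ler_sum.
Qed.

Lemma expect_le X Y : integrable_rv X -> integrable_rv Y ->
  (forall w, X w <= Y w) -> expect X <= expect Y.
Proof. by move=> iX iY XY; rewrite expect.unlock; exact: le_Rintegral. Qed.

Definition square_integrable X :=
  measurable_fun setT X /\ integrable_rv (fun w => X w ^+ 2).

Lemma square_integrable_cst c : square_integrable (fun=> c).
Proof. by split => //; exact: integrable_rv_cst. Qed.

Lemma integrable_rvM X Y : square_integrable X -> square_integrable Y ->
  integrable_rv (fun w => X w * Y w).
Proof.
move=> [mX iX] [mY iY]; apply: le_integrable_rv (integrable_rvD iX iY).
  exact: measurable_funM.
move=> w; rewrite normrM -(real_normK (num_real (X w))) -(real_normK (num_real (Y w))).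
have := sqr_ge0 (`|X w| - `|Y w|); have := sqr_ge0 (`|X w| + `|Y w|); lra.
Qed.

Lemma square_integrable_integrable X : square_integrable X -> integrable_rv X.
Proof.
move=> sX; have := integrable_rvM sX (square_integrable_cst 1).
by under [X in integrable_rv X]eq_fun do rewrite mulr1.
Qed.

Lemma le_square_integrable X Y : measurable_fun setT X ->
  (forall w, `|X w| <= `|Y w|) -> square_integrable Y -> square_integrable X.
Proof.
move=> mX XY [_ iY]; split=> //; apply: le_integrable_rv iY; first exact: measurable_funX.
by move=> w; rewrite normrX -(real_normK (num_real (Y w))) ler_sqr ?nnegrE.
Qed.

Lemma expect_sqr_le X Y : measurable_fun setT X ->
  (forall w, `|X w| <= `|Y w|) -> square_integrable Y ->
  expect (fun w => X w ^+ 2) <= expect (fun w => Y w ^+ 2).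
Proof.
move=> mX XY sY; have [_ iX] := le_square_integrable mX XY sY; have [_ iY] := sY.
apply: expect_le => // w; rewrite -(real_normK (num_real (X w))).
by rewrite -(real_normK (num_real (Y w))) ler_sqr ?nnegrE.
Qed.

Lemma square_integrableZ c X :
  square_integrable X -> square_integrable (fun w => c * X w).
Proof.
move=> [mX iX]; split; first exact: measurable_funM.
by under [X in integrable_rv X]eq_fun do rewrite exprMn; exact: integrable_rvZ.
Qed.

Lemma square_integrableD X Y : square_integrable X -> square_integrable Y ->
  square_integrable (fun w => X w + Y w).
Proof.
move=> sX sY; have [[mX iX] [mY iY]] := (sX, sY); split; first exact: measurable_funD.
under [X in integrable_rv X]eq_fun do rewrite sqrrD -mulr_natl.
apply: integrable_rvD => //; apply: integrable_rvD => //.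
by apply: integrable_rvZ; exact: integrable_rvM.
Qed.

Lemma square_integrableB X Y : square_integrable X -> square_integrable Y ->
  square_integrable (fun w => X w - Y w).
Proof.
move=> sX sY; have := square_integrableD sX (square_integrableZ (- 1) sY).
by under [X in square_integrable X]eq_fun do rewrite mulN1r.
Qed.

Lemma square_integrable_sum (J : Type) (r : seq J) (p : pred J) (X : J -> Omega -> R) :
  (forall j, p j -> square_integrable (X j)) ->
  square_integrable (fun w => \sum_(j <- r | p j) X j w).
Proof.
move=> sX; elim: r => [|j r IH].
  by under [X in square_integrable X]eq_fun do rewrite big_nil; exact: square_integrable_cst.
under [X in square_integrable X]eq_fun do rewrite big_cons.
by case: (p j) (sX j) => // /(_ isT) sXj; exact: square_integrableD.
Qed.

Lemma square_integrableM_bounded c X Y : measurable_fun setT X ->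
  (forall w, `|X w| <= c) -> square_integrable Y ->
  square_integrable (fun w => X w * Y w).
Proof.
move=> mX Xc [mY iY]; split; first exact: measurable_funM.
apply: le_integrable_rv (integrable_rvZ (c ^+ 2) iY).
  by apply: measurable_funX; exact: measurable_funM.
move=> w; rewrite ger0_norm ?sqr_ge0// exprMn ler_wpM2r ?sqr_ge0//.
by rewrite -(real_normK (num_real (X w))) ler_sqr ?nnegrE// (le_trans _ (Xc w)).
Qed.

Lemma expect_cauchy_schwarz X Y : square_integrable X -> square_integrable Y ->
  `|expect (fun w => X w * Y w)| <=
  Num.sqrt (expect (fun w => X w ^+ 2)) * Num.sqrt (expect (fun w => Y w ^+ 2)).
Proof.
move=> sX sY; have [iX iY] := (sX.2, sY.2); have iXY := integrable_rvM sX sY.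
apply: psd_form_cross_le => s t; rewrite -!expectZ//.
rewrite -!expectD//; do ?[exact: integrable_rvD|exact: integrable_rvZ].
  rewrite -(expect_cst 0); apply: expect_le; first exact: integrable_rv_cst.
    by apply: integrable_rvD; [apply: integrable_rvD|]; exact: integrable_rvZ.
  by move=> w; have := sqr_ge0 (s * X w + t * Y w); lra.
by apply: integrable_rvD; exact: integrable_rvZ.
Qed.

Lemma expect_sqrD_le X Y (t : R) : 0 < t ->
  square_integrable X -> square_integrable Y ->
  expect (fun w => (X w + Y w) ^+ 2) <=
  (1 + t) * expect (fun w => X w ^+ 2) + (1 + t^-1) * expect (fun w => Y w ^+ 2).
Proof.
move=> t_gt0 sX sY; have [_ iX] := sX; have [_ iY] := sY.
rewrite -!expectZ// -expectD; [|exact: integrable_rvZ..].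
apply: expect_le; first by have [] := square_integrableD sX sY.
  by apply: integrable_rvD; exact: integrable_rvZ.
move=> w; rewrite -subr_ge0.
rewrite (_ : _ - _ = t^-1 * (t * X w - Y w) ^+ 2); last by field; rewrite gt_eqF.
by rewrite mulr_ge0 ?sqr_ge0// invr_ge0 ltW.
Qed.

Lemma root_sum_sqr_moment (J : finType) (p : pred J) (X : J -> Omega -> R) (c : R) :
  (forall j, square_integrable (X j)) ->
  (forall j, expect (fun w => X j w ^+ 2) <= c) ->
  let root w := Num.sqrt (\sum_(j | p j) X j w ^+ 2) in
  square_integrable root /\ expect (fun w => root w ^+ 2) <= #|p|%:R * c.
Proof.
move=> sX Xc root; have rootE w : root w ^+ 2 = \sum_(j | p j) X j w ^+ 2.
  by rewrite sqr_sqrtr// sumr_ge0// => j _; exact: sqr_ge0.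
have isum : integrable_rv (fun w => \sum_(j | p j) X j w ^+ 2).
  by apply: integrable_rv_sum => j _; have [] := sX j.
rewrite /square_integrable (funext rootE); split; last first.
  by apply: expect_sum_le => // j _; have [] := sX j.
split=> //; apply: measurableT_comp (integrable_rv_measurable isum).
by apply: continuous_measurable_fun; exact: sqrt_continuous.
Qed.

End expectation.

(** * Independence *)

Section known.
Context {d : measure_display} {Omega : measurableType d} {R : realType}
  {P : probability Omega R} {I : choiceType} (xi : I -> {RV P >-> R}).
Implicit Types S : set I.

Definition cylinder (s : seq I) (A : I -> set R) : set Omega :=
  \bigcap_(i in [set i | i \in s]) (xi i @^-1` A i).

Definition cylinders S : set (set Omega) :=
  [set E | exists s A, [/\ uniq s, forall i, i \in s -> S i,
     forall i, measurable (A i) & E = cylinder s A]].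

Definition knowing S := g_sigma_algebraType (cylinders S).

HB.instance Definition _ S := Measurable.on (knowing S).

Definition known S (Y : Omega -> R) : Prop := measurable_fun [set: knowing S] Y.

Definition jointly_known S (Phi : R -> Omega -> R) : Prop :=
  measurable_fun [set: R * knowing S] (fun y => Phi y.1 y.2).

Lemma cylinders_setT S : cylinders S setT.
Proof. by exists [::], (fun=> setT); split => //; apply/seteqP; split=> // w _ i. Qed.

Lemma cylinders_setI S : setI_closed (cylinders S).
Proof.
move=> _ _ [s1 [A1 [_ sS1 mA1 ->]]] [s2 [A2 [_ sS2 mA2 ->]]].
pose A i := (if i \in s1 then A1 i else setT) `&` (if i \in s2 then A2 i else setT).
exists (undup (s1 ++ s2)), A; split.
- exact: undup_uniq.
- by move=> i; rewrite mem_undup mem_cat => /orP[/sS1|/sS2].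
- by move=> i; apply: measurableI; case: ifP.
apply/seteqP; split=> [w [wA1 wA2] i /= _|w wA].
  by split; case: ifPn => // ?; [exact: wA1|exact: wA2].
split=> i /= si; have := wA i; rewrite /= mem_undup mem_cat si ?orbT => /(_ isT).
- by case; rewrite si.
- by case=> _; rewrite si.
Qed.

Lemma cylinders_measurable S : cylinders S `<=` measurable.
Proof.
move=> _ [s [A [_ _ mA ->]]]; apply: fin_bigcap_measurable => // i _.
exact: measurable_funPTI.
Qed.

Lemma knowing_measurable S (E : set Omega) :
  measurable (E : set (knowing S)) -> measurable E.
Proof.
exact: (smallest_sub (@sigma_algebra_measurable _ Omega) (@cylinders_measurable S)).
Qed.

Lemma measurable_to_knowing S : measurable_fun setT (id : Omega -> knowing S).
Proof. by move=> _ E mE; rewrite setTI; exact: (@knowing_measurable S). Qed.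

Lemma known_measurable S Y : known S Y -> measurable_fun setT Y.
Proof. by move=> SY; exact: (measurableT_comp SY (@measurable_to_knowing S)). Qed.

Lemma known_sub S S' Y : S `<=` S' -> known S Y -> known S' Y.
Proof.
move=> SS' SY _ A mA; have := SY measurableT A mA.
apply: sub_smallest2r => [|E]; first exact: smallest_sigma_algebra.
by move=> [s [B [us sS mB ->]]]; exists s, B; split => // i /sS /SS'.
Qed.

Lemma known_xi S i : S i -> known S (xi i).
Proof.
move=> Si _ A mA; rewrite setTI; apply: sub_sigma_algebra.
exists [:: i], (fun=> A); split => //; first by move=> j; rewrite inE => /eqP ->.
apply/seteqP; split => [w wA j /=|w /(_ i)]; first by rewrite inE => /eqP ->.
by rewrite /= inE; exact.
Qed.

Lemma known_jointly S Y : known S Y -> jointly_known S (fun _ => Y).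
Proof. by move=> SY; exact: (measurableT_comp SY measurable_snd). Qed.

Definition with_xi S a (w : Omega) : R * knowing S := (xi a w, w).

Lemma measurable_with_xi S a : measurable_fun setT (with_xi S a).
Proof.
apply/measurable_fun_pairP; split; first exact: measurable_funP.
exact: measurable_to_knowing.
Qed.

End known.

Section independence.
Context {d : measure_display} {Omega : measurableType d} {R : realType}
  {P : probability Omega R} {I : choiceType} (xi : I -> {RV P >-> R}).
Hypothesis xi_indep : mutually_independent xi.
Implicit Types (S : set I) (a b : I).
Local Notation knowing := (knowing xi).

Lemma indep_cylinder (s : seq I) (B : I -> set R) a (A : set R) :
  uniq s -> a \notin s -> measurable A -> (forall i, measurable (B i)) ->
  P (xi a @^-1` A `&` cylinder xi s B) = (P (xi a @^-1` A) * P (cylinder xi s B))%E.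
Proof.
move=> us sa mA mB; pose B' i := if i == a then A else B i.
have B'E i : i \in s -> B' i = B i.
  by rewrite /B'; case: eqVneq => // ->; rewrite (negPf sa).
have -> : xi a @^-1` A `&` cylinder xi s B =
    \bigcap_(i in [set i | i \in a :: s]) (xi i @^-1` B' i).
  apply/seteqP; split=> [w [wA wB] i /=|w wB'].
    rewrite inE => /predU1P[->|si]; first by rewrite /B' eqxx.
    by rewrite B'E//; exact: wB.
  split=> [|i /= si]; last by rewrite -B'E//; apply: wB'; rewrite /= inE si orbT.
  by have := wB' a; rewrite /= inE eqxx /B' eqxx; exact.
rewrite xi_indep /= ?sa//; last by move=> i; rewrite /B'; case: ifP.
rewrite big_cons {1}/B' eqxx xi_indep//; congr (_ * _)%E.
by apply: eq_big_seq => i si; rewrite B'E.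
Qed.

Lemma indep_event S a (A : set R) (E : set (knowing S)) :
  ~ S a -> measurable A -> measurable E ->
  P (xi a @^-1` A `&` E) = (P (xi a @^-1` A) * P E)%E.
Proof.
move=> Sa mA mE; have mxA : measurable (xi a @^-1` A) by exact: measurable_funPTI.
have pA_ge0 : 0 <= fine (P (xi a @^-1` A)) by exact: fine_ge0.
pose restricted : {measure set Omega -> \bar R} := mrestr P mxA.
pose scaled : {measure set Omega -> \bar R} := mscale (NngNum pA_ge0) P.
have scaledE F : scaled F = (P (xi a @^-1` A) * P F)%E.
  rewrite -[P (xi a @^-1` A)]fineK//; exact: fin_num_measure.
rewrite setIC -scaledE -[LHS]/(restricted E).
apply: (@g_sigma_algebra_measure_unique _ _ _ (cylinders xi S) _ (fun=> setT) _ _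
  restricted scaled) => //.
- exact: cylinders_measurable.
- by move=> _; exact: cylinders_setT.
- by rewrite bigcup_const//; exists 0%N.
- exact: cylinders_setI.
- move=> _ [s [B [us sS mB ->]]]; rewrite scaledE -indep_cylinder// 1?setIC//.
  by apply/negP => /sS.
- move=> _; apply: le_lt_trans (ltry 1).
  exact: (probability_le1 P (measurableI _ _ measurableT mxA)).
Qed.

Definition to_knowing S (w : Omega) : knowing S := w.

HB.instance Definition _ S :=
  isMeasurableFun.Build _ _ _ _ (to_knowing S) (@measurable_to_knowing _ _ _ _ _ xi S).

HB.instance Definition _ S a :=
  isMeasurableFun.Build _ _ _ _ (with_xi xi S a) (@measurable_with_xi _ _ _ _ _ xi S a).

Local Notation joint_law S a :=
  (distribution P (xi a) \x distribution P (to_knowing S))%E.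

Lemma law_with_xi S a (E : set (R * knowing S)) : ~ S a -> measurable E ->
  joint_law S a E = distribution P (with_xi xi S a) E.
Proof.
move=> Sa mE; apply: product_measure_unique => // A B mA mB.
by rewrite /distribution /pushforward /= -(indep_event Sa mA mB).
Qed.

Local Open Scope ereal_scope.

Lemma integral_joint_law S a (Phi : R * knowing S -> \bar R) : ~ S a ->
  \int[joint_law S a]_y Phi y = \int[distribution P (with_xi xi S a)]_y Phi y.
Proof. by move=> Sa; apply: eq_measure_integral => A mA _; exact: law_with_xi. Qed.

Lemma indep_tonelli S a (Phi : R * knowing S -> \bar R) :
  ~ S a -> measurable_fun setT Phi -> (forall y, 0 <= Phi y) ->
  \int[P]_w Phi (xi a w, w) = \int[P]_w \int[distribution P (xi a)]_s Phi (s, w).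
Proof.
move=> Sa mPhi Phi0.
rewrite -(ge0_integral_distribution (with_xi xi S a))// -integral_joint_law//.
rewrite fubini_tonelli2// (ge0_integral_distribution (to_knowing S))//.
- exact: measurable_fun_fubini_tonelli_G.
- by move=> y; apply: integral_ge0.
Qed.

Lemma indep_fubini S a (Phi : R * knowing S -> \bar R) :
  ~ S a -> measurable_fun setT Phi ->
  P.-integrable setT (fun w => Phi (xi a w, w)) ->
  \int[P]_w Phi (xi a w, w) = \int[P]_w \int[distribution P (xi a)]_s Phi (s, w).
Proof.
move=> Sa mPhi iPhi.
have iprod : (joint_law S a).-integrable setT Phi.
  apply/integrableP; split => //; rewrite integral_joint_law//.
  have /integrableP[//] : (distribution P (with_xi xi S a)).-integrable setT Phi.
  by apply: integrable_pushforward => //; exact: measurable_with_xi.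
rewrite -(integral_distribution (X := with_xi xi S a))// -integral_joint_law//.
rewrite -integral21_prod_meas1//; have mG := measurable_fubini_G iprod.
rewrite integralE [RHS]integralE; congr (_ - _);
  rewrite (ge0_integral_distribution (to_knowing S))//.
- exact: measurable_funepos.
- exact: measurable_funeneg.
Qed.

Local Close Scope ereal_scope.

Lemma expect_indep_eq S a b (Phi Psi : R -> Omega -> R) : ~ S a -> ~ S b ->
  jointly_known xi S Phi -> jointly_known xi S Psi ->
  integrable_rv P (fun w => Phi (xi a w) w) ->
  integrable_rv P (fun w => Psi (xi b w) w) ->
  (forall w, \int[distribution P (xi a)]_s (Phi s w)%:E =
             \int[distribution P (xi b)]_s (Psi s w)%:E)%E ->
  expect P (fun w => Phi (xi a w) w) = expect P (fun w => Psi (xi b w) w).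
Proof.
move=> Sa Sb SPhi SPsi iPhi iPsi PhiPsi; rewrite expect.unlock /Rintegral; congr fine.
have fubini c Chi : ~ S c -> jointly_known xi S Chi ->
    integrable_rv P (fun w => Chi (xi c w) w) ->
    (\int[P]_w (Chi (xi c w) w)%:E =
     \int[P]_w \int[distribution P (xi c)]_s (Chi s w)%:E)%E.
  move=> Sc SChi; apply: (@indep_fubini S c (fun y => (Chi y.1 y.2)%:E)) => //.
  exact/measurable_EFinP.
rewrite (fubini a Phi)// (fubini b Psi)//.
by apply: eq_integral => w _; exact: PhiPsi.
Qed.

Lemma expect_exchange S a b (Phi : R -> Omega -> R) : ~ S a -> ~ S b ->
  jointly_known xi S Phi ->
  integrable_rv P (fun w => Phi (xi a w) w) ->
  integrable_rv P (fun w => Phi (xi b w) w) ->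
  (forall A, measurable A -> distribution P (xi a) A = distribution P (xi b) A) ->
  expect P (fun w => Phi (xi a w) w) = expect P (fun w => Phi (xi b w) w).
Proof.
move=> Sa Sb SPhi iPhia iPhib ab; apply: (expect_indep_eq Sa Sb) => // w.
by apply: eq_measure_integral => A mA _; exact: ab.
Qed.

Lemma expect_centered_mul S a (Y : Omega -> R) : ~ S a -> known xi S Y ->
  integrable_rv P (xi a) -> expect P (xi a) = 0 ->
  integrable_rv P (fun w => xi a w * Y w) ->
  expect P (fun w => xi a w * Y w) = 0.
Proof.
move=> Sa SY ixi xi0 ixiY; rewrite -[RHS](expect_cst P 0).
apply: (@expect_indep_eq S a a (fun s w => s * Y w) (fun _ _ => 0)) => //.
- by apply: measurable_funM => //; exact: (known_jointly SY).
- exact: measurable_cst.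
- exact: integrable_rv_cst.
move=> w; rewrite integral0; under eq_integral do rewrite mulrC EFinM.
have mid : measurable_fun [set: R] (fun s : R => s%:E) by apply/measurable_EFinP.
rewrite integralZl//; last by apply: integrable_pushforward.
by rewrite integral_distribution// -EFin_expect// xi0 mule0.
Qed.

Lemma square_integrable_indepM S a (Y : Omega -> R) : ~ S a -> known xi S Y ->
  square_integrable P (xi a) -> square_integrable P Y ->
  square_integrable P (fun w => xi a w * Y w) /\
  expect P (fun w => (xi a w * Y w) ^+ 2) =
    expect P (fun w => xi a w ^+ 2) * expect P (fun w => Y w ^+ 2).
Proof.
move=> Sa SY [ma ia] [mY iY].
have integralE : (\int[P]_w ((xi a w * Y w) ^+ 2)%:E =
    (expect P (fun w => xi a w ^+ 2) * expect P (fun w => Y w ^+ 2))%:E)%E.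
  rewrite (@indep_tonelli S a (fun y => ((y.1 * Y y.2) ^+ 2)%:E))//; last 2 first.
    - apply/measurable_EFinP; apply: measurable_funX; apply: measurable_funM => //.
      exact: (known_jointly SY).
    - by move=> y; rewrite lee_fin sqr_ge0.
  have inner w : (\int[distribution P (xi a)]_s ((s * Y w) ^+ 2)%:E =
      (expect P (fun w => xi a w ^+ 2))%:E * (Y w ^+ 2)%:E)%E.
    have msqr : measurable_fun [set: R] (fun s : R => (s ^+ 2)%:E).
      by apply/measurable_EFinP; exact: measurable_funX.
    under eq_integral do rewrite exprMn EFinM.
    rewrite ge0_integralZr//; do ?by move=> *; rewrite lee_fin sqr_ge0.
    rewrite ge0_integral_distribution//; last by move=> s; rewrite lee_fin sqr_ge0.
    by rewrite EFin_expect.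
  by under eq_integral do rewrite inner; rewrite integralZl//= -EFin_expect.
have mxiY : measurable_fun setT (fun w => xi a w * Y w) by exact: measurable_funM.
have ixiY : integrable_rv P (fun w => (xi a w * Y w) ^+ 2).
  apply: ge0_integrable_rv; [exact: measurable_funX|by move=> w; exact: sqr_ge0|].
  by rewrite integralE.
by split=> //; apply: EFin_inj; rewrite EFin_expect.
Qed.

End independence.

(** * Gaussian integrals *)

Section density.
Context {d : measure_display} {T : measurableType d} {R : realType}.
Variables (nu : {finite_measure set T -> \bar R})
  (mu : {sigma_finite_measure set T -> \bar R}) (p : T -> R).
Hypotheses (p_ge0 : forall x, 0 <= p x) (ip : mu.-integrable setT (EFin \o p)).
Hypothesis nuE :
  forall A, measurable A -> nu A = (\int[mu]_(x in A) (p x)%:E)%E.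
Local Open Scope ereal_scope.

Let mp : measurable_fun setT (fun x => (p x)%:E).
Proof. exact: measurable_int ip. Qed.

Lemma density_dominates : nu `<< mu.
Proof.
apply/null_content_dominatesP => A mA muA0; rewrite nuE//.
by apply: null_set_integral => //; exact: measurable_funTS.
Qed.

Let derivative : T -> \bar R := Radon_Nikodym_SigmaFinite.f nu mu.

Lemma derivative_ae_eq_density : ae_eq mu setT derivative (EFin \o p).
Proof.
have dom := density_dominates; apply: integral_ae_eq => //.
  exact: Radon_Nikodym_SigmaFinite.f_integrable.
by move=> A _ mA; rewrite -(Radon_Nikodym_SigmaFinite.f_integral dom mA) nuE.
Qed.

Lemma ge0_integral_density (f : T -> \bar R) : measurable_fun setT f ->
  (forall x, 0 <= f x) -> \int[nu]_x f x = \int[mu]_x (f x * (p x)%:E).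
Proof.
move=> mf f0; have dom := density_dominates.
have mderivative : measurable_fun setT derivative.
  exact: measurable_int (Radon_Nikodym_SigmaFinite.f_integrable dom).
rewrite -(Radon_Nikodym_SigmaFinite.change_of_variables dom)//.
apply: ae_eq_integral => //; [exact: emeasurable_funM|exact: emeasurable_funM|].
exact: ae_eqe_mul2l derivative_ae_eq_density.
Qed.

Lemma integral_density (f : T -> \bar R) : measurable_fun setT f ->
  \int[nu]_x f x = \int[mu]_x (f x * (p x)%:E).
Proof.
move=> mf; rewrite integralE [RHS]integralE; congr (_ - _).
- rewrite ge0_integral_density//; last exact: measurable_funepos.
  by apply: eq_integral => x _; rewrite !funeposE maxe_pMl ?mul0e ?lee_fin.
- rewrite ge0_integral_density//; last exact: measurable_funeneg.
  by apply: eq_integral => x _; rewrite !funenegE maxe_pMl ?mul0e ?lee_fin// mulNe.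
Qed.

Lemma integrable_densityP (f : T -> \bar R) : measurable_fun setT f ->
  nu.-integrable setT f <-> mu.-integrable setT (fun x => f x * (p x)%:E).
Proof.
move=> mf; have mfp : measurable_fun setT (fun x => f x * (p x)%:E).
  exact: emeasurable_funM.
have absE : \int[nu]_x `|f x| = \int[mu]_x `|f x * (p x)%:E|.
  rewrite ge0_integral_density//; last exact: measurableT_comp.
  by apply: eq_integral => x _; rewrite abseM (gee0_abs (x := (p x)%:E)) ?lee_fin.
by split=> /integrableP[_ fin]; apply/integrableP; rewrite ?absE// -absE.
Qed.

End density.

Section integral_of_derivative.
Context {R : realType}.
Local Notation mu := (@lebesgue_measure R).

Lemma is_derive_continuous (g g' : R -> R) :
  (forall x : R, is_derive x 1 g (g' x)) -> continuous g.
Proof.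
move=> dg x; apply: differentiable_continuous; apply/derivable1_diffP.
exact: ex_derive.
Qed.

Lemma cvg_integral_centered (f : R -> R) : mu.-integrable setT (EFin \o f) ->
  (\int[mu]_(x in `[(- n%:R)%R, n%:R%R]) (f x)%:E)%E @[n --> \oo] -->
  (\int[mu]_x (f x)%:E)%E.
Proof.
move=> fi; have mf : measurable_fun setT (EFin \o f) := measurable_int _ fi.
under eq_fun do rewrite integral_mkcond.
apply: (@dominated_cvg _ _ _ mu setT measurableT _ _ (abse \o (EFin \o f))) => //.
- by move=> n; apply/(measurable_restrictT _ _).1 => //; exact: measurable_funTS.
- move=> x _; apply: cvg_near_cst; near=> n; apply/eqP.
  rewrite patchE mem_set//= in_itv/= -ler_norml.
  by near: n; exact: nbhs_infty_ger.
- exact: integrable_abse.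
- by move=> n x _; rewrite patchE; case: ifPn; rewrite ?abse0 //= lee_fin.
Unshelve. all: by end_near. Qed.

Lemma integral_derive_setT (h h' : R -> R) (a b : R) :
  (forall x : R, is_derive x 1 h (h' x)) -> continuous h' ->
  mu.-integrable setT (EFin \o h') ->
  h (- n%:R) @[n --> \oo] --> a -> h n%:R @[n --> \oo] --> b ->
  (\int[mu]_x (h' x)%:E = (b - a)%:E)%E.
Proof.
move=> dh ch' ih' ha hb; have ch := is_derive_continuous dh.
have centeredE n : (\int[mu]_(x in `[(- n.+1%:R)%R, n.+1%:R%R]) (h' x)%:E)%E =
    (h n.+1%:R - h (- n.+1%:R))%:E.
  apply: continuous_FTC2; first by rewrite gtrN.
  - exact: continuous_subspaceT.
  - split=> [x _||]; first exact: ex_derive.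
    + by apply: cvg_at_right_filter; exact: ch.
    + by apply: cvg_at_left_filter; exact: ch.
  - by move=> x _; rewrite derive1E; exact: derive_val.
have := cvg_integral_centered ih'; rewrite -cvg_shiftS /=.
under eq_fun do rewrite centeredE.
move=> cvg_h'; apply: (cvg_unique _ cvg_h') => //.
apply: cvg_EFin; first exact: nearW.
apply: (@cvgB _ R^o).
- by rewrite (cvg_shiftS (fun n => h n%:R)).
- by rewrite (cvg_shiftS (fun n => h (- n%:R))).
Qed.

End integral_of_derivative.

Section polynomial_growth.
Context {R : realType}.
Implicit Types f g : R -> R.

Definition polynomially_bounded f : Prop :=
  exists n K, forall x, `|f x| <= K * (1 + `|x|) ^+ n.

Lemma polynomial_bound_ge0 f n (K : R) :
  (forall x, `|f x| <= K * (1 + `|x|) ^+ n) -> 0 <= K.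
Proof. by move=> /(_ 0); rewrite normr0 addr0 expr1n mulr1; exact: le_trans. Qed.

Lemma polynomially_bounded_idM f :
  polynomially_bounded f -> polynomially_bounded (fun x => x * f x).
Proof.
move=> [n [K fK]]; exists n.+1, K => x; rewrite normrM exprS mulrCA ler_pM//.
by rewrite lerDr.
Qed.

Lemma polynomially_bounded_bounded f (K : R) :
  (forall x, `|f x| <= K) -> polynomially_bounded f.
Proof. by move=> fK; exists 0, K => x; rewrite expr0 mulr1. Qed.

Lemma polynomially_boundedX n : polynomially_bounded (fun x : R => x ^+ n).
Proof.
elim: n => [|n IH].
  by apply: (@polynomially_bounded_bounded _ 1) => x; rewrite expr0 normr1.
by have := polynomially_bounded_idM IH; under eq_fun do rewrite -exprS.
Qed.

Lemma polynomially_boundedZ c f :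
  polynomially_bounded f -> polynomially_bounded (fun x => c * f x).
Proof.
by move=> [n [K fK]]; exists n, (`|c| * K) => x; rewrite normrM -mulrA ler_wpM2l.
Qed.

Lemma polynomially_bounded_primitive g g' :
  (forall x : R, is_derive x 1 g (g' x)) ->
  polynomially_bounded g' -> polynomially_bounded g.
Proof.
move=> dg [n [K g'K]]; exists n.+1, (`|g 0| + K) => x.
have K_ge0 := polynomial_bound_ge0 g'K.
have cg : continuous g by exact: is_derive_continuous dg.
have [c c_le gE] : exists2 c, `|c| <= `|x| & g x - g 0 = g' c * x.
  have [x_ge0|/ltW x_le0] := leP 0 x.
    have [c /[!in_itv]/= /andP[c0 cx] ->] := MVT_segment x_ge0 (fun y _ => dg y)
      (continuous_subspaceT cg).
    by exists c; rewrite ?subr0// !ger0_norm.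
  have [c /[!in_itv]/= /andP[cx c0] gE] := MVT_segment x_le0 (fun y _ => dg y)
    (continuous_subspaceT cg).
  exists c; first by rewrite !ler0_norm// lerN2.
  by rewrite -opprB gE sub0r mulrN opprK.
have x_le : `|x| <= 1 + `|x| by rewrite lerDr.
have pow_ge1 : 1 <= (1 + `|x|) ^+ n.+1 by rewrite exprn_ege1// lerDl.
rewrite -(subrK (g 0) (g x)) addrC mulrDl (le_trans (ler_normD _ _))// lerD//.
  by rewrite ler_peMr.
rewrite gE normrM exprSr mulrA ler_pM// (le_trans (g'K c))// ler_wpM2l//.
by rewrite lerXn2r ?nnegrE ?addr_ge0// lerD2l.
Qed.

Lemma expr_le_fact_expR n (x : R) : 0 <= x -> x ^+ n <= n`!%:R * expR x.
Proof.
move=> x0; case: n => [|n]; first by rewrite expr0 mul1r -[leLHS]expR0 ler_expR.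
rewrite -ler_pdivrMl ?ltr0n ?fact_gt0// mulrC.
by apply: le_trans (expR_ge1Dxn n x0); rewrite lerDr.
Qed.

End polynomial_growth.

Section standard_normal.
Context {R : realType}.
Notation mu := (@lebesgue_measure R).
Notation N01 := (@normal_prob R 0 1).
Notation phi := (@normal_pdf R 0 1).

Lemma standard_normal_pdfE (x : R) : phi x = normal_peak 1 * expR (- x ^+ 2 / 2).
Proof.
by rewrite normal_pdfE ?oner_neq0//; congr (_ * expR _); rewrite subr0 expr1n.
Qed.

Lemma polynomial_normal_pdf_le n : exists2 C : R, 0 <= C &
  forall x : R, (1 + `|x|) ^+ n * phi x <= C * normal_pdf 0 (Num.sqrt 2) x.
Proof.
have sqrt2_neq0 : Num.sqrt 2 != 0 :> R by rewrite gt_eqF ?sqrtr_gt0.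
have peak_gt0 : 0 < normal_peak (Num.sqrt 2) :> R by exact: normal_peak_gt0.
exists (n`!%:R * expR 2 * (normal_peak 1 / normal_peak (Num.sqrt 2))) => [|x].
  by rewrite !mulr_ge0 ?expR_ge0 ?invr_ge0 ?(ltW peak_gt0) ?normal_peak_ge0.
rewrite standard_normal_pdfE normal_pdfE// /normal_fun subr0 sqr_sqrtr//.
rewrite [leRHS](_ : _ = normal_peak 1 *
    (n`!%:R * (expR 2 * expR (- x ^+ 2 / (2 *+ 2))))); last by field; exact: lt0r_neq0.
rewrite mulrCA ler_wpM2l ?normal_peak_ge0// -expRD.
have abs_le : 1 + `|x| <= 2 + x ^+ 2 / 4.
  by rewrite -(real_normK (num_real x)); have := sqr_ge0 (`|x| - 2); lra.
apply: (@le_trans _ _ (n`!%:R * expR (1 + `|x|) * expR (- x ^+ 2 / 2))).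
  by rewrite ler_wpM2r ?expR_ge0// expr_le_fact_expR// addr_ge0.
by rewrite -mulrA -expRD ler_wpM2l// ler_expR; lra.
Qed.

Let integrable_densityNP f : measurable_fun setT f ->
  N01.-integrable setT f <-> mu.-integrable setT (fun x => f x * (phi x)%:E)%E.
Proof.
apply: (@integrable_densityP _ _ _ N01 mu) => //; last exact: integrable_normal_pdf.
exact: normal_pdf_ge0.
Qed.

Let integral_densityN f : measurable_fun setT f ->
  (\int[N01]_x f x = \int[mu]_x (f x * (phi x)%:E))%E.
Proof.
apply: (@integral_density _ _ _ N01 mu) => //; last exact: integrable_normal_pdf.
exact: normal_pdf_ge0.
Qed.

Lemma normal_integrable (f : R -> R) : measurable_fun setT f ->
  polynomially_bounded f -> N01.-integrable setT (EFin \o f).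
Proof.
move=> mf [n [K fK]]; apply/integrable_densityNP; first exact/measurable_EFinP.
have [C C_ge0 CP] := polynomial_normal_pdf_le n.
have := integrableZl measurableT (K * C) (integrable_normal_pdf 0 (Num.sqrt 2 : R)).
apply: le_integrable => //.
  apply: emeasurable_funM; apply/measurable_EFinP => //; exact: measurable_normal_pdf.
move=> x _; rewrite -!EFinM !abse_EFin lee_fin (le_trans _ (ler_norm _))//.
rewrite normrM (ger0_norm (normal_pdf_ge0 _ _ _)).
have K_ge0 := polynomial_bound_ge0 fK.
apply: le_trans (ler_wpM2r (normal_pdf_ge0 0 1 x) (fK x)) _.
by rewrite -!mulrA ler_wpM2l.
Qed.

Lemma polynomially_bounded_normal_pdf_cvg0 (g : R -> R) (u : nat -> R) :
  polynomially_bounded g -> (forall n, `|u n| = n%:R) ->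
  g (u n) * phi (u n) @[n --> \oo] --> 0.
Proof.
move=> [n [K gK]] uE; have [C C_ge0 CP] := polynomial_normal_pdf_le n.+1.
have sqrt2_neq0 : Num.sqrt 2 != 0 :> R by rewrite gt_eqF ?sqrtr_gt0.
have K_ge0 := polynomial_bound_ge0 gK.
pose D := K * (C * normal_peak (Num.sqrt 2)).
have decay x : `|g x * phi x| <= D / (1 + `|x|).
  have x1_ge0 : 0 <= 1 + `|x| by rewrite addr_ge0.
  rewrite ler_pdivlMr ?ltr_pwDl// normrM (ger0_norm (normal_pdf_ge0 _ _ _)).
  apply: (@le_trans _ _ (K * ((1 + `|x|) ^+ n.+1 * phi x))).
    rewrite exprSr [leRHS](_ : _ = K * (1 + `|x|) ^+ n * phi x * (1 + `|x|)); last by ring.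
    by rewrite !ler_wpM2r ?normal_pdf_ge0.
  by rewrite ler_wpM2l// (le_trans (CP x))// ler_wpM2l// normal_pdf_ub.
apply: norm_cvg0; apply: (@squeeze_cvgr _ _ _ _ (cst 0) (fun m => D * harmonic m)).
- apply: nearW => m; rewrite normr_ge0 /harmonic /= -natr1 addrC -(uE m).
  exact: decay.
- exact: cvg_cst.
- by rewrite -[X in _ --> X](mulr0 D); apply: cvgMr; exact: cvg_harmonic.
Qed.

Lemma is_derive_standard_normal_pdf (x : R) : is_derive x 1 phi (- x * phi x).
Proof.
rewrite (funext standard_normal_pdfE).
have dsqr : is_derive x 1 (fun y : R => - y ^+ 2 / 2) (- x).
  have -> : (fun y : R => - y ^+ 2 / 2) = (- 2^-1) *: (id : R -> R) ^+ 2.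
    by apply/funext => y; rewrite mulNr mulrC -mulNr.
  by apply: is_derive_eq; rewrite /GRing.scale /= /GRing.scale /=; field.
have dexp := is_derive1_comp (is_derive_expR _) dsqr.
have -> : (fun y : R => normal_peak 1 * expR (- y ^+ 2 / 2)) =
   normal_peak 1 *: (expR \o (fun y : R => - y ^+ 2 / 2)) by [].
by apply: is_derive_eq; rewrite /GRing.scale /=; ring.
Qed.

(* [(g phi)' = (g' - s g) phi] has integral zero. *)
Lemma stein (g g' : R -> R) : (forall s : R, is_derive s 1 g (g' s)) ->
  continuous g' -> polynomially_bounded g' ->
  (\int[N01]_s (s * g s)%:E = \int[N01]_s (g' s)%:E)%E.
Proof.
move=> dg cg' bg'; have bg := polynomially_bounded_primitive dg bg'.
have cg := is_derive_continuous dg.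
have cphi : continuous phi by apply: continuous_normal_pdf; exact: oner_neq0.
have mg' : measurable_fun setT g' by exact: continuous_measurable_fun.
have msg : measurable_fun [set: R] (fun s : R => s * g s).
  by apply: measurable_funM => //; exact: continuous_measurable_fun.
have isg : mu.-integrable setT (fun s => (s * g s * phi s)%:E).
  have /integrable_densityNP := normal_integrable msg (polynomially_bounded_idM bg).
  by apply; exact/measurable_EFinP.
have ig' : mu.-integrable setT (fun s => (g' s * phi s)%:E).
  by have /integrable_densityNP := normal_integrable mg' bg'; apply; exact/measurable_EFinP.
pose h' s := g' s * phi s - s * g s * phi s.
have dh (s : R) : is_derive s 1 (fun s => g s * phi s) (h' s).
  apply: (is_derive_eq (is_deriveM (dg s) (is_derive_standard_normal_pdf s))).
  by rewrite /h' /GRing.scale /=; ring.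
have ch' : continuous h'.
  move=> s; apply: (@cvgB _ R^o); first by apply: cvgM; [exact: cg'|exact: cphi].
  by apply: cvgM; [apply: cvgM; [exact: cvg_id|exact: cg]|exact: cphi].
have h'0 : (\int[mu]_s (h' s)%:E = 0)%E.
  rewrite (integral_derive_setT dh ch' (a := 0) (b := 0)) ?subrr//.
  - exact: (integrableB measurableT ig' isg).
  - by apply: polynomially_bounded_normal_pdf_cvg0 => // n; rewrite normrN normr_nat.
  - by apply: polynomially_bounded_normal_pdf_cvg0 => // n; exact: normr_nat.
rewrite !integral_densityN; do ?exact/measurable_EFinP.
have := integralB measurableT ig' isg; rewrite -[LHS]/(\int[mu]_s (h' s)%:E)%E h'0.
move=> /esym/eqP; rewrite sube_eq//; last exact: integrable_fin_num.
by rewrite add0e => /eqP.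
Qed.

Lemma normal_moment_recurrence n :
  (\int[N01]_s (s ^+ n.+2)%:E = n.+1%:R%:E * \int[N01]_s (s ^+ n)%:E)%E.
Proof.
have dX (s : R) : is_derive s 1 (fun s : R => s ^+ n.+1) (n.+1%:R * s ^+ n).
  have := is_deriveX n.+1 (is_derive_id s 1); rewrite exprfctE.
  by move=> /is_derive_eq; apply; rewrite /GRing.scale /= mulr1.
under eq_integral do rewrite exprS.
rewrite (stein dX).
- under eq_integral do rewrite EFinM.
  rewrite integralZl//; apply: normal_integrable; first exact: measurable_funX.
  exact: polynomially_boundedX.
- by move=> s; apply: cvgM; [exact: cvg_cst|exact: exprn_continuous].
- by apply: polynomially_boundedZ; exact: polynomially_boundedX.
Qed.

Lemma normal_second_moment : (\int[N01]_s (s ^+ 2)%:E = 1)%E.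
Proof.
rewrite normal_moment_recurrence mul1e (integral_cst N01 measurableT 1%E) mul1e.
exact: (probability_setT N01).
Qed.

Lemma normal_fourth_moment : (\int[N01]_s (s ^+ 4)%:E = 3%:E)%E.
Proof. by rewrite normal_moment_recurrence normal_second_moment mule1. Qed.

End standard_normal.

Section standard_normal_variable.
Context {d : measure_display} {Omega : measurableType d} {R : realType}
  {P : probability Omega R}.

Definition standard_normal (Y : {RV P >-> R}) : Prop :=
  forall A : set R, measurable A -> distribution P Y A = normal_prob 0 1 A.

(* The normal law lives on [measurableTypeR R], which has the Borel sets of [R]
   but another display. *)
Definition to_borel (x : R) : measurableTypeR R := x.

Lemma measurable_to_borel : measurable_fun setT to_borel.
Proof. by move=> _ A mA; rewrite setTI. Qed.

HB.instance Definition _ :=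
  isMeasurableFun.Build _ _ _ _ to_borel measurable_to_borel.

Lemma integral_normal_law (Q : probability R R) (g : R -> \bar R) :
  measurable_fun setT g ->
  (forall A : set R, measurable A -> Q A = normal_prob 0 1 A) ->
  (\int[Q]_s g s = \int[normal_prob 0 1]_s g s)%E.
Proof.
move=> mg QN; have mgR : measurable_fun [set: measurableTypeR R] g by exact mg.
rewrite -(@eq_measure_integral _ (measurableTypeR R) R setT (normal_prob 0 1)
  (distribution Q to_borel)); last by move=> A mA _; exact: QN.
rewrite [LHS]integralE [RHS]integralE; congr (_ - _)%E.
- by rewrite ge0_integral_distribution//; exact: measurable_funepos.
- by rewrite ge0_integral_distribution//; exact: measurable_funeneg.
Qed.

Variables (Y : {RV P >-> R}).
Hypothesis Y_normal : standard_normal Y.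

Lemma integral_standard_normal (g : R -> \bar R) : measurable_fun setT g ->
  (\int[distribution P Y]_s g s = \int[normal_prob 0 1]_s g s)%E.
Proof. by move=> mg; exact: integral_normal_law. Qed.

Lemma integrable_standard_normal (g : R -> R) : measurable_fun setT g ->
  polynomially_bounded g -> integrable_rv P (fun w => g (Y w)).
Proof.
move=> mg bg; have /integrableP[mgE fin] := normal_integrable mg bg.
apply/integrableP; split; first by apply/measurable_EFinP; exact: measurableT_comp.
have mabs : measurable_fun [set: R] (fun s : R => `|(g s)%:E|)%E.
  by apply: measurableT_comp => //; exact/measurable_EFinP.
by move: fin; rewrite -(integral_standard_normal mabs) ge0_integral_distribution.
Qed.

Lemma expect_standard_normal (g : R -> R) : measurable_fun setT g ->
  polynomially_bounded g ->
  ((expect P (fun w => g (Y w)))%:E = \int[normal_prob 0 1]_s (g s)%:E)%E.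
Proof.
move=> mg bg; have ig := integrable_standard_normal mg bg.
have mgE : measurable_fun [set: R] (fun s : R => (g s)%:E) by exact/measurable_EFinP.
by rewrite EFin_expect// -(integral_standard_normal mgE) integral_distribution.
Qed.

Lemma square_integrable_standard_normalX n : square_integrable P (fun w => Y w ^+ n).
Proof.
split; first by apply: measurable_funX; exact: measurable_funP.
under [X in integrable_rv _ X]eq_fun do rewrite -exprM.
apply: (@integrable_standard_normal (fun s => s ^+ (n * 2))).
  exact: measurable_funX.
exact: polynomially_boundedX.
Qed.

Lemma square_integrable_standard_normal : square_integrable P Y.
Proof. exact: (square_integrable_standard_normalX 1). Qed.

Lemma standard_normal_second_moment : expect P (fun w => Y w ^+ 2) = 1.
Proof.
apply: EFin_inj; rewrite (@expect_standard_normal (fun s => s ^+ 2)).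
- exact: normal_second_moment.
- exact: measurable_funX.
- exact: polynomially_boundedX.
Qed.

Lemma standard_normal_fourth_moment : expect P (fun w => Y w ^+ 4) = 3.
Proof.
apply: EFin_inj; rewrite (@expect_standard_normal (fun s => s ^+ 4)).
- exact: normal_fourth_moment.
- exact: measurable_funX.
- exact: polynomially_boundedX.
Qed.

End standard_normal_variable.

Lemma expect_stein {d : measure_display} {Omega : measurableType d} {R : realType}
    {P : probability Omega R} {I : choiceType} (xi : I -> {RV P >-> R})
    (S : set I) (a : I) (g g' : R -> Omega -> R) (K : Omega -> R) :
  mutually_independent xi -> ~ S a -> standard_normal (xi a) ->
  jointly_known xi S g -> jointly_known xi S g' ->
  (forall w (s : R), is_derive s 1 (g ^~ w) (g' s w)) ->
  (forall w, continuous (g' ^~ w)) -> (forall w s, `|g' s w| <= K w) ->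
  integrable_rv P (fun w => xi a w * g (xi a w) w) ->
  integrable_rv P (fun w => g' (xi a w) w) ->
  expect P (fun w => xi a w * g (xi a w) w) = expect P (fun w => g' (xi a w) w).
Proof.
move=> xi_indep Sa Na Sg Sg' dg cg' g'K ixg ig'.
apply: (expect_indep_eq xi_indep Sa Sa (Phi := fun s w => s * g s w)) => // [|w].
  exact: measurable_funM.
have mg := continuous_measurable_fun (is_derive_continuous (dg w)).
have msg : measurable_fun [set: R] (fun s : R => s * g s w) by exact: measurable_funM.
have mg' : measurable_fun [set: R] (g' ^~ w) by exact: continuous_measurable_fun.
rewrite !(integral_standard_normal Na); [|exact/measurable_EFinP..].
by apply: (stein (dg w)) => //; exact: polynomially_bounded_bounded (g'K w).
Qed.

(** * Euclidean geometry *)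

Section euclidean.
Context {R : realType} {m : nat}.
Implicit Types (x y v : 'rV[R]_m) (k : 'I_m).

Definition dot x y : R := \sum_k x ord0 k * y ord0 k.

Lemma coordB x y k : (x - y) ord0 k = x ord0 k - y ord0 k.
Proof. by rewrite !mxE. Qed.

Lemma norm2_ge0 x : 0 <= norm2 x. Proof. exact: sqrtr_ge0. Qed.

Lemma sqr_norm2 x : norm2 x ^+ 2 = \sum_k x ord0 k ^+ 2.
Proof. by rewrite sqr_sqrtr// sumr_ge0// => k _; exact: sqr_ge0. Qed.

Lemma dotxx x : dot x x = norm2 x ^+ 2.
Proof. by rewrite sqr_norm2; apply: eq_bigr => k _; rewrite expr2. Qed.

Lemma dotC x y : dot x y = dot y x.
Proof. by apply: eq_bigr => k _; rewrite mulrC. Qed.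

Lemma dotDr x y v : dot x (y + v) = dot x y + dot x v.
Proof. by rewrite /dot -big_split; apply: eq_bigr => k _; rewrite mxE mulrDr. Qed.

Lemma dotZr a x y : dot x (a *: y) = a * dot x y.
Proof. by rewrite /dot mulr_sumr; apply: eq_bigr => k _; rewrite mxE mulrCA. Qed.

Lemma dotNr x y : dot x (- y) = - dot x y.
Proof. by rewrite -scaleN1r dotZr mulN1r. Qed.

Lemma dotBl x y v : dot (x - y) v = dot x v - dot y v.
Proof. by rewrite dotC dotDr dotNr !(dotC v). Qed.

Lemma dot_sumr (J : Type) (r : seq J) (p : pred J) x (y : J -> 'rV[R]_m) :
  dot x (\sum_(j <- r | p j) y j) = \sum_(j <- r | p j) dot x (y j).
Proof.
rewrite /dot exchange_big; apply: eq_bigr => k _.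
by rewrite summxE mulr_sumr.
Qed.

Lemma dot_delta x a k : dot x (a *: delta_mx ord0 k) = a * x ord0 k.
Proof.
rewrite dotZr /dot (bigD1 k)//= mxE !eqxx mulr1 big1 ?addr0// => j /negPf jk.
by rewrite mxE jk andbF mulr0.
Qed.

Lemma sqrt_partial_sum_le_norm2 (p : pred 'I_m) x :
  Num.sqrt (\sum_(k | p k) x ord0 k ^+ 2) <= norm2 x.
Proof.
rewrite ler_wsqrtr// [leRHS](bigID p)/= lerDl.
by apply: sumr_ge0 => k _; exact: sqr_ge0.
Qed.

Lemma partial_dot_le_sqrt (p : pred 'I_m) x (b : 'I_m -> R) :
  `|\sum_(k | p k) x ord0 k * b k| <= norm2 x * Num.sqrt (\sum_(k | p k) b k ^+ 2).
Proof.
apply: le_trans (cauchy_schwarz_sum _ _ _) _.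
by rewrite ler_wpM2r ?sqrtr_ge0// sqrt_partial_sum_le_norm2.
Qed.

Lemma partial_dot_le (p : pred 'I_m) x y :
  `|\sum_(k | p k) x ord0 k * y ord0 k| <= norm2 x * norm2 y.
Proof.
apply: le_trans (partial_dot_le_sqrt _ _ _) _.
by rewrite ler_wpM2l ?norm2_ge0// sqrt_partial_sum_le_norm2.
Qed.

(* [gx hx - gy hy = (gx - gy) hx + gy (hx - hy)]. *)
Lemma partial_dot_stale_ge (p : pred 'I_m) (gx gy hx hy : 'rV[R]_m) (b : 'I_m -> R)
    (C delta : R) :
  norm2 (gx - gy) <= delta -> norm2 (hx - hy) <= delta ->
  norm2 gy <= C -> norm2 hx <= C ->
  \sum_(k | p k) gx ord0 k * hx ord0 k
    - (delta * Num.sqrt (\sum_(k | p k) b k ^+ 2) + 2 * C * delta) <=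
  \sum_(k | p k) ((gx - gy) ord0 k * b k + gy ord0 k * hy ord0 k).
Proof.
move=> gxy hxy gyC hxC.
have delta_ge0 : 0 <= delta by exact: le_trans (norm2_ge0 _) gxy.
have C_ge0 : 0 <= C by exact: le_trans (norm2_ge0 _) gyC.
have changeE : \sum_(k | p k) gx ord0 k * hx ord0 k =
    \sum_(k | p k) (gx - gy) ord0 k * hx ord0 k
    + \sum_(k | p k) gy ord0 k * (hx - hy) ord0 k
    + \sum_(k | p k) gy ord0 k * hy ord0 k.
  by rewrite -!big_split; apply: eq_bigr => k _; rewrite !mxE /=; ring.
have stale_b := partial_dot_le_sqrt p (gx - gy) b.
have stale_h := partial_dot_le p (gx - gy) hx.
have stale_g := partial_dot_le p gy (hx - hy).
have le_b := ler_wpM2r (sqrtr_ge0 (\sum_(k | p k) b k ^+ 2)) gxy.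
have le_h := ler_pM (norm2_ge0 _) (norm2_ge0 _) gxy hxC.
have le_g := ler_pM (norm2_ge0 _) (norm2_ge0 _) gyC hxy.
rewrite big_split /= changeE.
move: stale_b stale_h stale_g; rewrite !ler_norml => /andP[? _] /andP[_ ?] /andP[_ ?].
by lra.
Qed.

Lemma normr_dot_le x y : `|dot x y| <= norm2 x * norm2 y.
Proof. exact: (partial_dot_le predT). Qed.

Lemma dot_le x y : dot x y <= norm2 x * norm2 y.
Proof. exact: le_trans (ler_norm _) (normr_dot_le x y). Qed.

Lemma norm2Z a x : norm2 (a *: x) = `|a| * norm2 x.
Proof.
rewrite /norm2 -(sqrtr_sqr a) -sqrtrM ?sqr_ge0// mulr_sumr; congr Num.sqrt.
by apply: eq_bigr => k _; rewrite mxE exprMn.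
Qed.

Lemma norm2N x : norm2 (- x) = norm2 x.
Proof. by rewrite -scaleN1r norm2Z normrN1 mul1r. Qed.

Lemma norm2_distC x y : norm2 (x - y) = norm2 (y - x).
Proof. by rewrite -norm2N opprB. Qed.

Lemma norm2_0 : norm2 (0 : 'rV[R]_m) = 0.
Proof. by rewrite -(scale0r 0) norm2Z normr0 mul0r. Qed.

Lemma norm2D x y : norm2 (x + y) <= norm2 x + norm2 y.
Proof.
rewrite -ler_sqr ?nnegrE ?addr_ge0 ?norm2_ge0// -dotxx dotDr !(dotC (x + y)) !dotDr.
by rewrite !dotxx (dotC y x) sqrrD mulr2n; have := dot_le x y; lra.
Qed.

Lemma norm2_midpoint_le x y (c : R) :
  norm2 x <= c -> norm2 y <= c -> norm2 (2^-1 *: (x + y)) <= c.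
Proof.
move=> xc yc; rewrite norm2Z ger0_norm ?invr_ge0//.
by have := norm2D x y; lra.
Qed.

Lemma norm2_sum (J : Type) (r : seq J) (p : pred J) (F : J -> 'rV[R]_m) :
  norm2 (\sum_(j <- r | p j) F j) <= \sum_(j <- r | p j) norm2 (F j).
Proof.
elim/big_ind2 : _ => [||//]; first by rewrite norm2_0.
by move=> x1 x2 y1 y2 le1 le2; apply: le_trans (norm2D _ _) _; exact: lerD.
Qed.

Lemma norm2_mean_le (n : nat) (x : 'I_n -> 'rV[R]_m) (c : R) : 0 <= c ->
  (forall i, norm2 (x i) <= c) -> norm2 (n%:R^-1 *: \sum_i x i) <= c.
Proof.
move=> c_ge0 xc; rewrite norm2Z ger0_norm ?invr_ge0//.
apply: le_trans (mean_le c_ge0 xc).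
by rewrite ler_wpM2l ?invr_ge0// norm2_sum.
Qed.

Lemma coord_le_norm2 x k : `|x ord0 k| <= norm2 x.
Proof.
have := sqrt_partial_sum_le_norm2 (pred1 k) x.
by rewrite big_pred1_eq sqrtr_sqr.
Qed.

Lemma norm2_delta k : norm2 (delta_mx ord0 k : 'rV[R]_m) = 1.
Proof.
rewrite -[LHS]ger0_norm ?norm2_ge0// -sqrtr_sqr -dotxx -[X in dot _ X]scale1r.
by rewrite dot_delta mxE !eqxx mulr1 sqrtr1.
Qed.

Lemma norm2_le_mx_norm x : norm2 x <= m%:R * `|x|.
Proof.
rewrite {1}(row_sum_delta x); apply: le_trans (norm2_sum _ _ _) _.
rewrite mulr_natl -[X in _ *+ X]card_ord -sumr_const; apply: ler_sum => k _.
rewrite norm2Z norm2_delta mulr1 -[`|x|]/(mx_norm x) mx_normrE.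
exact: (le_bigmax 0 (fun ij => `|x ij.1 ij.2|) (ord0, k)).
Qed.

Lemma lipschitz2_norm2 : lipschitz2 1 (@norm2 R m).
Proof.
move=> x y; rewrite mul1r ler_norml; apply/andP; split.
  by rewrite lerBrDl lerBlDr norm2_distC addrC -{1}(subrK x y) norm2D.
by rewrite lerBlDr -{1}(subrK y x) norm2D.
Qed.

Lemma lipschitz2_continuous (K : R) (g : 'rV[R]_m -> R) :
  lipschitz2 K g -> continuous g.
Proof.
move=> gK x; pose C := `|K| * m%:R + 1.
have C_gt0 : 0 < C by rewrite ltr_wpDl// mulr_ge0.
apply/(@cvgrPdist_lt _ _ _ (nbhs x)) => e e_gt0; apply/nbhs_ballP.
exists (e / C) => /= [|y]; first exact: divr_gt0.
rewrite mx_norm_ball /ball_ /= ltr_pdivlMr// => xy; apply: le_lt_trans (gK x y) _.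
apply: le_lt_trans xy; apply: (@le_trans _ _ (`|K| * (m%:R * `|x - y|))).
  apply: le_trans (ler_wpM2r (norm2_ge0 _) (ler_norm K)) _.
  by rewrite ler_wpM2l ?norm2_le_mx_norm.
by rewrite mulrA [leRHS]mulrC ler_wpM2r// lerDl.
Qed.

End euclidean.

(** * Continuous functions of measurable coordinates *)

Section measurable_coordinates.
Context {R : realType} {m : nat}.
Implicit Types (x : 'rV[R]_m) (U : set 'rV[R]_m).

Definition rational_row (q : {ffun 'I_m -> rat}) : 'rV[R]_m := \row_k ratr (q k).

Lemma open_rational_ball U x : open U -> U x -> exists q (r : rat),
  ball (rational_row q) (ratr r) x /\ ball (rational_row q) (ratr r) `<=` U.
Proof.
rewrite openE => oU /oU /nbhs_ballP[e /= e_gt0 xeU].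
have [r] := @rat_in_itvoo R 0 (e / 2) (divr_gt0 e_gt0 (ltr0n R 2)).
rewrite in_itv /= => /andP[r_gt0 re].
have near_coord k : exists q : rat, `|x ord0 k - ratr q| < ratr r.
  have [q] := @rat_in_itvoo R (x ord0 k - ratr r) (x ord0 k + ratr r) ltac:(lra).
  by rewrite in_itv /= => q_in; exists q; rewrite distrC ltr_distl.
pose q := [ffun k => projT1 (cid (near_coord k))].
have qx : ball (rational_row q) (ratr r) x.
  split=> // i k; rewrite ord1 mxE ffunE; case: cid => /= s.
  by rewrite -ball_normE /= distrC.
exists q, r; split=> // y qy; apply: xeU.
by apply: (@le_ball _ _ _ (ratr r + ratr r)); [lra|exact: ball_triangle (ball_sym qx) qy].
Qed.

Context {d : measure_display} {T : measurableType d} (X : T -> 'rV[R]_m).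
Hypothesis mX : forall k, measurable_fun setT (fun w => X w ord0 k).

Lemma measurable_preimage_ball x (e : R) : measurable (X @^-1` ball x e).
Proof.
have [e_gt0|e_le0] := ltP 0 e; last first.
  rewrite [X in measurable X](_ : _ = set0)//; apply/seteqP; split=> // w [e_gt0 _].
  by move: e_le0; rewrite leNgt e_gt0.
have -> : X @^-1` ball x e =
    \bigcap_(k in [set: 'I_m]) [set w | `|x ord0 k - X w ord0 k| < e].
  apply/seteqP; split=> [w [_ Xw] k _|w Xw].
    by have := Xw ord0 k; rewrite -ball_normE.
  by split=> // i k; rewrite ord1 -ball_normE; exact: Xw.
apply: fin_bigcap_measurable => // k _; rewrite -[X in measurable X]setTI.
apply: measurable_fun_ltr => //; apply: measurableT_comp => //.
exact: measurable_funB.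
Qed.

Lemma measurable_preimage_open U : open U -> measurable (X @^-1` U).
Proof.
move=> oU; pose B (qr : {ffun 'I_m -> rat} * rat) := ball (rational_row qr.1) (ratr qr.2).
have -> : X @^-1` U = \bigcup_qr (if `[< B qr `<=` U >] then X @^-1` B qr else set0).
  apply/seteqP; split=> [w /(open_rational_ball oU)[q [r [Xw qrU]]]|w [qr _]].
    by exists (q, r) => //; case: asboolP.
  by case: asboolP => // BU Xw; exact: BU.
apply: countable_bigcupT_measurable; first exact: countableP.
by move=> qr; case: ifP => // _; exact: measurable_preimage_ball.
Qed.

Lemma measurable_continuous_row (g : 'rV[R]_m -> R) :
  continuous g -> measurable_fun setT (fun w => g (X w)).
Proof.
move=> cg; apply: (measurability _ (RGenInftyO.measurableE R)) => _ [_ [a ->] <-].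
rewrite setTI; apply: (@measurable_preimage_open (g @^-1` `]-oo, a[%classic)).
by apply: open_comp; [move=> x _; exact: cg|exact: interval_open].
Qed.

End measurable_coordinates.

(** * Smooth functions *)

Section smooth.
Context {R : realType} {m : nat}.
Implicit Types (f : 'rV[R]_m -> R) (x y v : 'rV[R]_m).

Lemma derive_gradient f x v : differentiable f x -> 'D_v f x = dot (gradient f x) v.
Proof.
move=> df; rewrite deriveE// {1}(row_sum_delta v) linear_sum /dot.
by apply: eq_bigr => k _; rewrite linearZ /= mxE deriveE// mulrC.
Qed.

Lemma is_derive_line f x v (t : R) : differentiable f (x + t *: v) ->
  is_derive t 1 (fun s : R => f (x + s *: v)) (dot (gradient f (x + t *: v)) v).
Proof.
move=> df; rewrite -derive_gradient//.
have quotientE : (fun h : R => h^-1 *: (((fun s : R => f (x + s *: v)) \o shift t) (h *: 1)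
      - f (x + t *: v))) =
    (fun h : R => h^-1 *: ((f \o shift (x + t *: v)) (h *: v) - f (x + t *: v))).
  apply/funext => h /=; congr (_ *: (f _ - _)).
  by rewrite -[h *: 1]/(h * 1) mulr1 scalerDl addrCA.
have dv : derivable f (x + t *: v) v by exact: diff_derivable.
by apply: DeriveDef; rewrite /derivable /derive quotientE.
Qed.

Lemma norm2_gradient_le f (G : R) x : 0 <= G -> lipschitz2 G f ->
  differentiable f x -> norm2 (gradient f x) <= G.
Proof.
move=> G_ge0 fG df; set v := gradient f x.
have [->//|v_neq0] := eqVneq (norm2 v) 0.
have v_gt0 : 0 < norm2 v by rewrite lt0r v_neq0 norm2_ge0.
rewrite -(ler_pM2r v_gt0) -expr2 -dotxx -derive_gradient//.
apply: limr_le; first exact: diff_derivable.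
near=> h.
have h_neq0 : h != 0 by near: h; exact: nbhs_dnbhs_neq.
rewrite (le_trans (ler_norm _))// normrM normfV.
rewrite ler_pdivrMl ?normr_gt0// (le_trans (fG _ _))//.
by rewrite addrK norm2Z mulrCA.
Unshelve. all: by end_near. Qed.

Lemma lipschitz2_partial f (L : R) k : smooth2 L f ->
  lipschitz2 L (fun x => gradient f x ord0 k).
Proof.
move=> [_ Lf] x y; apply: le_trans (Lf x y).
by apply: le_trans (coord_le_norm2 _ k); rewrite !mxE.
Qed.

Lemma continuous_line (g : 'rV[R]_m -> R) x v :
  continuous g -> continuous (fun s : R => g (x + s *: v)).
Proof.
move=> cg s; apply: (@continuous_comp _ _ _ (fun s : R => x + s *: v) g); last exact: cg.
by apply: continuousD; [exact: cst_continuous|exact: scalel_continuous].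
Qed.

Definition replace_coord (k : 'I_m) (s : R) x : 'rV[R]_m :=
  \row_l (if l == k then s else x ord0 l).

Lemma replace_coord_id k x s : x ord0 k = s -> replace_coord k s x = x.
Proof. by move=> <-; apply/rowP => l; rewrite mxE; case: eqP => [->|]. Qed.

Lemma replace_coord_line k s x v r : x + r *: replace_coord k s v =
  (x + r *: replace_coord k 0 v) + s *: (r *: delta_mx ord0 k).
Proof. by apply/rowP => l; rewrite !mxE eqxx /=; case: eqP => _ /=; ring. Qed.

Lemma is_derive_replace_coord f k x v (r s : R) :
  differentiable f (x + r *: replace_coord k s v) ->
  is_derive s 1 (fun s => f (x + r *: replace_coord k s v))
    (r * gradient f (x + r *: replace_coord k s v) ord0 k).
Proof.
under eq_fun do rewrite replace_coord_line; rewrite replace_coord_line => df.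
by rewrite -dot_delta; exact: is_derive_line.
Qed.

Lemma continuous_replace_coord (g : 'rV[R]_m -> R) k x v (r : R) :
  continuous g -> continuous (fun s : R => g (x + r *: replace_coord k s v)).
Proof.
by move=> cg; under eq_fun do rewrite replace_coord_line; exact: continuous_line.
Qed.

(* Along the segment, [f] minus its quadratic upper model is nonincreasing. *)
Lemma smooth_descent f (L : R) x v : smooth2 L f ->
  f (x + v) <= f x + dot (gradient f x) v + L / 2 * norm2 v ^+ 2.
Proof.
move=> [df Lf]; pose slope := dot (gradient f x) v; pose q := L * norm2 v ^+ 2.
pose gap (s : R) := f (x + s *: v) - (slope * s + q / 2 * s ^+ 2).
have dgap (s : R) :
    is_derive s 1 gap (dot (gradient f (x + s *: v)) v - (slope + q * s)).
  apply: (is_deriveB (is_derive_line (df _))).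
  apply: (is_derive_eq (is_deriveD (is_deriveZ slope (is_derive_id s 1))
    (is_deriveZ (q / 2) (is_deriveX 2 (is_derive_id s 1))))).
  by rewrite /GRing.scale /= expr1; field.
have gap'_le0 (s : R) : 0 < s -> dot (gradient f (x + s *: v)) v - (slope + q * s) <= 0.
  move=> s_gt0; rewrite subr_le0 -lerBlDl -dotBl; apply: le_trans (dot_le _ _) _.
  apply: le_trans (ler_wpM2r (norm2_ge0 v) (Lf _ _)) _.
  by rewrite addrC addKr norm2Z gtr0_norm// /q expr2; lra.
have : gap 1 <= gap 0.
  apply: (@ler0_derive1_le_cc R gap 0 1); rewrite ?in_itv /= ?lexx ?ler01//.
  - by move=> s; rewrite in_itv /= => /andP[s_gt0 _]; rewrite derive1E derive_val gap'_le0.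
  - by apply: continuous_subspaceT; exact: is_derive_continuous dgap.
rewrite /gap scale1r scale0r addr0 expr0n /= !mulr0 !mulr1 expr1n mulr1.
by rewrite /q /slope; lra.
Qed.

Definition smoothed_gradient f (u : R) x y : 'rV[R]_m :=
  2^-1 *: (gradient f (x + u *: y) + gradient f (x + (- u) *: y)).

Lemma norm2_smoothed_gradient_le f (G u : R) x y :
  (forall x, norm2 (gradient f x) <= G) -> norm2 (smoothed_gradient f u x y) <= G.
Proof. by move=> fG; exact: norm2_midpoint_le. Qed.

Lemma smoothed_gradient_lipschitz f (L u : R) x x' y : smooth2 L f ->
  norm2 (smoothed_gradient f u x y - smoothed_gradient f u x' y) <= L * norm2 (x - x').
Proof.
move=> [_ Lf]; have shift r : x + r *: y - (x' + r *: y) = x - x'.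
  by rewrite opprD addrACA subrr addr0.
rewrite -scalerBr opprD addrACA.
by apply: norm2_midpoint_le; apply: le_trans (Lf _ _) _; rewrite shift.
Qed.

Lemma smoothed_gradient_bias f (L u : R) x y : smooth2 L f ->
  norm2 (smoothed_gradient f u x y - gradient f x) <= L * (`|u| * norm2 y).
Proof.
move=> [_ Lf]; have midpointB (a b e : 'rV[R]_m) :
    2^-1 *: (a + b) - e = 2^-1 *: ((a - e) + (b - e)).
  by apply/rowP => k; rewrite !mxE; field.
rewrite midpointB; apply: norm2_midpoint_le; apply: le_trans (Lf _ _) _;
  by rewrite (addrC x) addrK norm2Z ?normrN.
Qed.

End smooth.

Section objective.
Context {R : realType} {n : nat} {dim : 'I_n -> nat} (G L : R)
  (f : 'I_n -> profile R dim -> R).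
Hypothesis fP : problem G L f.
Hypothesis L_ge0 : 0 <= L.

Lemma objectiveE : objective f = n%:R^-1 *: (\sum_i f i).
Proof. by apply/funext => y; rewrite /objective fctE /= fct_sumE. Qed.

Lemma objective_differentiable x : differentiable (objective f) x.
Proof.
rewrite objectiveE; apply: differentiableZ; apply: differentiable_sum => i.
by have [] := cost_smooth fP i.
Qed.

Lemma objective_gradient x :
  gradient (objective f) x = n%:R^-1 *: \sum_i gradient (f i) x.
Proof.
apply/rowP => k; rewrite !mxE summxE objectiveE.
have df i : derivable (f i) x (delta_mx ord0 k).
  by apply: diff_derivable; have [] := cost_smooth fP i.
rewrite deriveZ; last exact: derivable_sum.
by rewrite derive_sum//; congr (_ * _); apply: eq_bigr => i _; rewrite mxE.
Qed.

Lemma objective_lipschitz : 0 <= G -> lipschitz2 G (objective f).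
Proof.
move=> G_ge0 x y; rewrite /objective -mulrBr -sumrB normrM ger0_norm ?invr_ge0//.
have norm_ge0 : 0 <= G * norm2 (x - y) by rewrite mulr_ge0 ?norm2_ge0.
apply: le_trans (mean_le norm_ge0 (fun i => cost_lipschitz fP i x y)).
by rewrite ler_wpM2l ?invr_ge0// ler_norm_sum.
Qed.

Lemma objective_smooth : smooth2 L (objective f).
Proof.
split; first exact: objective_differentiable.
move=> x y; rewrite !objective_gradient -scalerBr -sumrB.
apply: norm2_mean_le => [|i]; first by rewrite mulr_ge0 ?norm2_ge0.
by have [_] := cost_smooth fP i.
Qed.

Lemma smoothed_alignment (u : R) x y : (0 < n)%N ->
  n%:R * (7 / 8 * norm2 (gradient (objective f) x) ^+ 2
          - 2 * L ^+ 2 * u ^+ 2 * norm2 y ^+ 2) <=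
  \sum_j dot (gradient (objective f) x) (smoothed_gradient (f j) u x y).
Proof.
move=> n_gt0; set g := gradient _ x; set bias := 2 * L ^+ 2 * u ^+ 2 * norm2 y ^+ 2.
have sum_gradient : \sum_i dot g (gradient (f i) x) = n%:R * norm2 g ^+ 2.
  by rewrite -dotxx {3}/g objective_gradient dotZr dot_sumr mulVKf ?pnatr_eq0 -?lt0n.
have align_j j : - (norm2 g ^+ 2 / 8 + bias) <=
    dot g (smoothed_gradient (f j) u x y) - dot g (gradient (f j) x).
  rewrite -dotNr -dotDr.
  have := normr_dot_le g (smoothed_gradient (f j) u x y - gradient (f j) x).
  have := ler_wpM2l (norm2_ge0 g) (smoothed_gradient_bias u x y (cost_smooth fP j)).
  rewrite ler_norml => bias_le /andP[ge _]; apply: le_trans ge; move: bias_le.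
  have := sqr_ge0 (norm2 g - 4 * (L * (`|u| * norm2 y))).
  by rewrite /bias -(real_normK (num_real u)); lra.
have := @ler_sum _ _ (index_enum 'I_n) predT _ _ (fun j _ => align_j j).
by rewrite sumr_const card_ord sumrB sum_gradient -mulr_natl; lra.
Qed.

Lemma infimum_le x : infimum (objective f) <= objective f x.
Proof. by apply: ge_inf; [exact: (objective_bounded fP)|exists x]. Qed.

End objective.

(** * Two-point gradient estimates *)

Section random_rows.
Context {d : measure_display} {Omega : measurableType d} {R : realType}
  {P : probability Omega R} {I : choiceType} (xi : I -> {RV P >-> R}) {m : nat}.
Implicit Types (S : set I) (X Z V : Omega -> 'rV[R]_m).

Definition known_row S X : Prop := forall k, known xi S (fun w => X w ord0 k).

Definition xi_row (alpha : 'I_m -> I) (w : Omega) : 'rV[R]_m := \row_k xi (alpha k) w.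

Lemma known_row_sub S S' X : S `<=` S' -> known_row S X -> known_row S' X.
Proof. by move=> SS' SX k; exact: known_sub (SX k). Qed.

Lemma known_xi_row S alpha : (forall k, S (alpha k)) -> known_row S (xi_row alpha).
Proof.
move=> Salpha k; rewrite /known; under eq_fun do rewrite mxE.
exact: known_xi (Salpha k).
Qed.

Lemma known_xi_row_setT alpha : known_row setT (xi_row alpha).
Proof. exact: known_xi_row. Qed.

Lemma known_rowD S X Z (r : R) :
  known_row S X -> known_row S Z -> known_row S (fun w => X w + r *: Z w).
Proof.
move=> SX SZ k; rewrite /known; under eq_fun do rewrite !mxE.
apply: measurable_funD; first exact: SX.
by apply: measurable_funM; [exact: measurable_cst|exact: SZ].
Qed.

Lemma known_continuous S X (g : 'rV[R]_m -> R) :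
  continuous g -> known_row S X -> known xi S (fun w => g (X w)).
Proof. by move=> cg SX; exact: measurable_continuous_row. Qed.

Lemma jointly_known_replace_coord S X V (k : 'I_m) (r : R) (g : 'rV[R]_m -> R) :
  continuous g -> known_row S X ->
  (forall l, l != k -> known xi S (fun w => V w ord0 l)) ->
  jointly_known xi S (fun s w => g (X w + r *: replace_coord k s (V w))).
Proof.
move=> cg SX SV; apply: measurable_continuous_row => // l.
under eq_fun do rewrite !mxE; have [lk|lk] := eqVneq l k.
  by apply: measurable_funD; [exact: (known_jointly (SX l))|exact: measurable_funM].
apply: measurable_funD; first exact: (known_jointly (SX l)).
by apply: measurable_funM; [exact: measurable_cst|exact: (known_jointly (SV l lk))].
Qed.

End random_rows.

Section normal_rows.
Context {d : measure_display} {Omega : measurableType d} {R : realType}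
  {P : probability Omega R} {I : choiceType} (xi : I -> {RV P >-> R}) {m : nat}.
Variables (alpha : 'I_m -> I).
Hypothesis alpha_normal : forall k, standard_normal (xi (alpha k)).
Local Notation Z := (xi_row xi alpha).

Lemma sqr_norm2_xi_row w : norm2 (Z w) ^+ 2 = \sum_k xi (alpha k) w ^+ 2.
Proof. by rewrite sqr_norm2; apply: eq_bigr => k _; rewrite mxE. Qed.

Lemma norm2_xi_row_moment : square_integrable P (fun w => norm2 (Z w)) /\
  expect P (fun w => norm2 (Z w) ^+ 2) <= m%:R.
Proof.
have coord_le k : expect P (fun w => xi (alpha k) w ^+ 2) <= 1.
  by rewrite standard_normal_second_moment.
have [sZ eZ] := @root_sum_sqr_moment _ _ _ P _ predT (fun k => xi (alpha k)) 1
  (fun k => square_integrable_standard_normal (alpha_normal k)) coord_le.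
have normE w : norm2 (Z w) = Num.sqrt (\sum_(k | predT k) xi (alpha k) w ^+ 2).
  by rewrite -sqr_norm2_xi_row sqrtr_sqr ger0_norm ?norm2_ge0.
split; first by rewrite (funext normE).
under [X in expect _ X]eq_fun do rewrite normE.
by move: eZ; rewrite card_ord mulr1.
Qed.

Let integrable_sqrM k l :
  integrable_rv P (fun w => xi (alpha l) w ^+ 2 * xi (alpha k) w ^+ 2).
Proof.
by apply: integrable_rvM; apply: square_integrable_standard_normalX; exact: alpha_normal.
Qed.

Let sqr_norm2M k w : (norm2 (Z w) * xi (alpha k) w) ^+ 2 =
  \sum_l xi (alpha l) w ^+ 2 * xi (alpha k) w ^+ 2.
Proof. by rewrite exprMn sqr_norm2_xi_row mulr_suml. Qed.

Lemma square_integrable_norm2M_xi_row k :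
  square_integrable P (fun w => norm2 (Z w) * xi (alpha k) w).
Proof.
split; first by apply: measurable_funM => //; have [[]] := norm2_xi_row_moment.
under [X in integrable_rv _ X]eq_fun do rewrite sqr_norm2M.
by apply: integrable_rv_sum => l _; exact: integrable_sqrM.
Qed.

Lemma expect_sqr_norm2M_xi_row_le k :
  expect P (fun w => (norm2 (Z w) * xi (alpha k) w) ^+ 2) <= 3 * m%:R.
Proof.
under [X in expect _ X]eq_fun do rewrite sqr_norm2M.
rewrite -[m in leRHS]card_ord mulrC; apply: expect_sum_le => l _; first exact: integrable_sqrM.
have i4 j : integrable_rv P (fun w => xi (alpha j) w ^+ 4).
  have [_] := square_integrable_standard_normalX (alpha_normal j) 2.
  by under eq_fun do rewrite -exprM.
have e4 j := standard_normal_fourth_moment (alpha_normal j).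
apply: (@le_trans _ _ (expect P
  (fun w => 2^-1 * (xi (alpha l) w ^+ 4 + xi (alpha k) w ^+ 4)))).
  apply: expect_le; [exact: integrable_sqrM|by apply: integrable_rvZ; exact: integrable_rvD|].
  by move=> w; have := sqr_ge0 (xi (alpha l) w ^+ 2 - xi (alpha k) w ^+ 2); lra.
by rewrite expectZ ?expectD ?e4//; [lra|exact: integrable_rvD].
Qed.

End normal_rows.

Definition centered_noise {d : measure_display} {Omega : measurableType d}
    {R : realType} (P : probability Omega R) (sigma : R) (Y : Omega -> R) : Prop :=
  [/\ square_integrable P Y, expect P Y = 0 &
      expect P (fun w => Y w ^+ 2) <= sigma ^+ 2].

Lemma centered_noise_of_variance {d : measure_display} {Omega : measurableType d}
    {R : realType} (P : probability Omega R) (sigma : R) (Y : {RV P >-> R}) :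
  ('E_P[Y] = 0)%E -> ('V_P[Y] <= (sigma ^+ 2)%:E)%E -> centered_noise P sigma Y.
Proof.
move=> Y0 VY.
have Y2 : (\int[P]_w (Y w ^+ 2)%:E <= (sigma ^+ 2)%:E)%E.
  move: VY; rewrite /variance covariance.unlock Y0 expectation.unlock.
  rewrite (eq_integral (fun w => (Y w ^+ 2)%:E))// => w _ /=.
  by rewrite !fctE /= subr0 expr2.
have iY : integrable_rv P (fun w => Y w ^+ 2).
  apply: ge0_integrable_rv Y2; first exact: measurable_funX.
  by move=> w; exact: sqr_ge0.
split; first by split.
- by move: Y0; rewrite expectation.unlock expect.unlock /Rintegral => ->.
- by rewrite -lee_fin EFin_expect.
Qed.

Definition two_point_difference {R : realType} {m : nat} (f : 'rV[R]_m -> R) (u : R)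
    (x z : 'rV[R]_m) (a b : R) : R :=
  ((f (x + u *: z) + a) - (f (x - u *: z) + b)) / (2 * u).

Definition two_point_variance {R : realType} (m : nat) (G sigma u : R) : R :=
  5 / 8 * (sigma ^+ 2 / u ^+ 2) + 15 * G ^+ 2 * m%:R.

Lemma two_point_variance_ge0 {R : realType} m (G sigma u : R) :
  0 <= two_point_variance m G sigma u.
Proof.
apply: addr_ge0; last by rewrite mulr_ge0// mulr_ge0// sqr_ge0.
by apply: mulr_ge0; rewrite divr_ge0// sqr_ge0.
Qed.

Section perturbed_gradient.
Context {d : measure_display} {Omega : measurableType d} {R : realType}
  {P : probability Omega R} {I : choiceType} (xi : I -> {RV P >-> R}) {m : nat}.
Hypothesis xi_indep : mutually_independent xi.
Variables (G L : R) (f : 'rV[R]_m -> R).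
Hypotheses (G_ge0 : 0 <= G) (f_lipschitz : lipschitz2 G f) (f_smooth : smooth2 L f).
Variables (S : set I) (X : Omega -> 'rV[R]_m) (v : Omega -> R) (c : R).
Hypotheses (SX : known_row xi S X) (Sv : known xi S v) (v_le : forall w, `|v w| <= c).
Implicit Types (k : 'I_m) (r : R).

Lemma normr_partial_le x k : `|gradient f x ord0 k| <= G.
Proof.
apply: le_trans (coord_le_norm2 _ _) _.
by apply: norm2_gradient_le => //; have [] := f_smooth.
Qed.

Let f_continuous : continuous f.
Proof. exact: lipschitz2_continuous f_lipschitz. Qed.

Let partial_continuous k : continuous (fun x => gradient f x ord0 k).
Proof. exact: lipschitz2_continuous (lipschitz2_partial k f_smooth). Qed.

Let X_setT : known_row xi setT X.
Proof. exact: known_row_sub (@subsetT _ S) SX. Qed.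

Let v_setT : known xi setT v.
Proof. exact: known_sub (@subsetT _ S) Sv. Qed.

Definition perturbed_partial k r (V : Omega -> 'rV[R]_m) (w : Omega) : R :=
  v w * gradient f (X w + r *: V w) ord0 k.

Lemma integrable_perturbed_partial k r (V : Omega -> 'rV[R]_m) :
  known_row xi setT V -> integrable_rv P (perturbed_partial k r V).
Proof.
move=> mV; apply: (le_integrable_rv _ _ (integrable_rv_cst P (c * G))).
  apply: (@known_measurable _ _ _ _ _ xi setT); apply: measurable_funM => //.
  by apply: (known_continuous (@partial_continuous k)); exact: known_rowD.
by move=> w; rewrite normrM ler_pM// normr_partial_le.
Qed.

Lemma expect_weighted_smoothed_gradient k u (V : Omega -> 'rV[R]_m) :
  known_row xi setT V ->
  integrable_rv P (fun w => v w * smoothed_gradient f u (X w) (V w) ord0 k) /\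
  expect P (fun w => v w * smoothed_gradient f u (X w) (V w) ord0 k) =
  2^-1 * (expect P (perturbed_partial k u V) + expect P (perturbed_partial k (- u) V)).
Proof.
move=> mV; have iplus := integrable_perturbed_partial k u mV.
have iminus := integrable_perturbed_partial k (- u) mV.
have splitE : (fun w => v w * smoothed_gradient f u (X w) (V w) ord0 k) =
    fun w => 2^-1 * (perturbed_partial k u V w + perturbed_partial k (- u) V w).
  apply/funext => w; rewrite /smoothed_gradient mxE [in LHS]mxE mulrCA.
  by rewrite /perturbed_partial mulrDr.
rewrite splitE; split; first by apply: integrable_rvZ; exact: integrable_rvD.
by rewrite expectZ ?expectD//; exact: integrable_rvD.
Qed.

Section exchange.
Variables (alpha beta : 'I_m -> I).
Hypotheses (alpha_fresh : forall k, ~ S (alpha k)) (beta_fresh : forall k, ~ S (beta k)).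
Hypotheses (alpha_inj : injective alpha) (beta_inj : injective beta)
  (alpha_beta : forall k l, alpha k = beta l -> k = l).
Hypothesis same_law : forall k A, measurable A ->
  distribution P (xi (alpha k)) A = distribution P (xi (beta k)) A.

Let hybrid (j : nat) : 'I_m -> I := fun l => if (l < j)%N then beta l else alpha l.

Let replace_hybrid (o : 'I_m) w j : (o <= j <= o.+1)%N ->
  xi_row xi (hybrid j) w =
  replace_coord o (xi (hybrid j o) w) (xi_row xi (hybrid o) w).
Proof.
move=> oj; apply/rowP => l; rewrite !mxE /hybrid; case: eqVneq => [->//|lo].
have lo' : (l != o :> nat)%N by [].
by rewrite (_ : (l < j)%N = (l < o)%N)//; lia.
Qed.

Lemma exchange_coordinate k r (o : 'I_m) :
  expect P (perturbed_partial k r (xi_row xi (hybrid o))) =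
  expect P (perturbed_partial k r (xi_row xi (hybrid o.+1))).
Proof.
pose others : set I := [set i | i <> alpha o /\ i <> beta o].
have S_others : S `<=` others.
  by move=> i Si; split=> iE; move: Si; rewrite iE; [exact: alpha_fresh|exact: beta_fresh].
pose Phi (s : R) w := v w *
  gradient f (X w + r *: replace_coord o s (xi_row xi (hybrid o) w)) ord0 k.
have hybrid_o : hybrid o o = alpha o by rewrite /hybrid ltnn.
have hybrid_oS : hybrid o.+1 o = beta o by rewrite /hybrid ltnSn.
have PhiE j (oj : (o <= j <= o.+1)%N) : perturbed_partial k r (xi_row xi (hybrid j)) =
    fun w => Phi (xi (hybrid j o) w) w.
  by apply/funext => w; rewrite /Phi -replace_hybrid.
have iPhi j (oj : (o <= j <= o.+1)%N) : integrable_rv P (fun w => Phi (xi (hybrid j o) w) w).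
  by rewrite -PhiE//; apply: integrable_perturbed_partial; exact: known_xi_row.
have [at_o at_oS] : (o <= o <= o.+1)%N /\ (o <= o.+1 <= o.+1)%N by rewrite leqnSn !leqnn.
rewrite (PhiE _ at_o) (PhiE _ at_oS) hybrid_o hybrid_oS.
apply: (expect_exchange xi_indep (S := others)) => //.
- by move=> [].
- by move=> [].
- apply: measurable_funM; first exact: (known_jointly (known_sub S_others Sv)).
  apply: (jointly_known_replace_coord _ (@partial_continuous k)).
    exact: known_row_sub S_others SX.
  move=> l /eqP lo; rewrite /known; under eq_fun do rewrite mxE.
  apply: known_xi; rewrite /hybrid; case: ifP => _; split=> eq_index; apply: lo.
  + exact/esym/alpha_beta/esym.
  + exact: beta_inj.
  + exact: alpha_inj.
  + exact: alpha_beta.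
- by rewrite -hybrid_o; exact: iPhi.
- by rewrite -hybrid_oS; exact: iPhi.
- by move=> A mA; exact: same_law.
Qed.

(* One coordinate is exchanged at a time. *)
Lemma exchange_perturbation k r :
  expect P (perturbed_partial k r (xi_row xi alpha)) =
  expect P (perturbed_partial k r (xi_row xi beta)).
Proof.
have hybridm : xi_row xi beta = xi_row xi (hybrid m).
  by apply/funext => w; apply/rowP => l; rewrite !mxE /hybrid ltn_ord.
have exchange_first j : (j <= m)%N -> expect P (perturbed_partial k r (xi_row xi alpha)) =
    expect P (perturbed_partial k r (xi_row xi (hybrid j))).
  elim: j => [//|j IH] jm.
  by rewrite (IH (ltnW jm)); exact: (exchange_coordinate k r (Ordinal jm)).
by rewrite hybridm; exact: exchange_first.
Qed.

Lemma exchange_smoothed_gradient k u :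
  expect P (fun w => v w * smoothed_gradient f u (X w) (xi_row xi alpha w) ord0 k) =
  expect P (fun w => v w * smoothed_gradient f u (X w) (xi_row xi beta w) ord0 k).
Proof.
have [_ alphaE] := expect_weighted_smoothed_gradient k u (known_xi_row_setT alpha).
have [_ betaE] := expect_weighted_smoothed_gradient k u (known_xi_row_setT beta).
apply: etrans alphaE (etrans _ (esym betaE)).
by rewrite (exchange_perturbation k u) (exchange_perturbation k (- u)).
Qed.

End exchange.

Section stein.
Variable alpha : 'I_m -> I.
Hypotheses (alpha_fresh : forall k, ~ S (alpha k)) (alpha_inj : injective alpha).
Hypothesis alpha_normal : forall k, standard_normal (xi (alpha k)).
Local Notation Z := (xi_row xi alpha).

Definition increment r (w : Omega) : R := f (X w + r *: Z w) - f (X w).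

Lemma increment_le r w : `|increment r w| <= `|r| * G * norm2 (Z w).
Proof.
apply: le_trans (f_lipschitz _ _) _.
by rewrite addrC addKr norm2Z mulrA (mulrC G).
Qed.

Lemma integrable_weighted_increment k r :
  integrable_rv P (fun w => v w * (xi (alpha k) w * increment r w)).
Proof.
have iZ := square_integrable_integrable (square_integrable_norm2M_xi_row alpha_normal k).
apply: le_integrable_rv (integrable_rvZ (c * (`|r| * G)) (integrable_rv_norm iZ)).
  apply: (@known_measurable _ _ _ _ _ xi setT); apply: measurable_funM => //.
  apply: measurable_funM; first exact: known_xi.
  apply: measurable_funB; apply: (known_continuous f_continuous) => //.
  by apply: known_rowD => //; exact: known_xi_row.
move=> w; rewrite !normrM (ger0_norm (norm2_ge0 _)) -!mulrA ler_pM//.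
by rewrite mulrC !mulrA ler_wpM2r// increment_le.
Qed.

Lemma stein_increment k r :
  expect P (fun w => v w * (xi (alpha k) w * increment r w)) =
  r * expect P (perturbed_partial k r Z).
Proof.
pose others : set I := [set~ alpha k].
have S_others : S `<=` others by move=> i Si iE; move: Si; rewrite iE; exact: alpha_fresh.
have known_others l : l != k -> others (alpha l) by move=> /eqP lk /alpha_inj.
pose point s w := X w + r *: replace_coord k s (Z w).
pose g s w := v w * (f (point s w) - f (X w)).
pose g' s w := v w * (r * gradient f (point s w) ord0 k).
have point_id w : point (xi (alpha k) w) w = X w + r *: Z w.
  by rewrite /point replace_coord_id// mxE.
have gE : (fun w => xi (alpha k) w * g (xi (alpha k) w) w) =
    (fun w => v w * (xi (alpha k) w * increment r w)).
  by apply/funext => w; rewrite /g point_id mulrCA.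
have g'E : (fun w => g' (xi (alpha k) w) w) = (fun w => r * perturbed_partial k r Z w).
  by apply/funext => w; rewrite /g' point_id mulrCA.
have joint_point h : continuous h -> jointly_known xi others (fun s w => h (point s w)).
  move=> ch; apply: (jointly_known_replace_coord _ ch) => [|l lk].
    exact: known_row_sub S_others SX.
  by rewrite /known; under eq_fun do rewrite mxE; apply: known_xi; exact: known_others.
have joint_v := known_jointly (known_sub S_others Sv).
have joint_fX := known_jointly
  (known_continuous f_continuous (known_row_sub S_others SX)).
have ipartial := integrable_perturbed_partial k r (known_xi_row_setT alpha).
rewrite -expectZ; last exact: ipartial.
rewrite -gE -g'E; apply: (expect_stein xi_indep (S := others)
  (K := fun w => `|v w| * (`|r| * G)) _ (alpha_normal k)).
- by apply.
- by apply: (measurable_funM joint_v); apply: measurable_funB; [exact: joint_point|].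
- apply: (measurable_funM joint_v); apply: measurable_funM; first exact: measurable_cst.
  exact: (joint_point _ (@partial_continuous k)).
- move=> w s; have df := is_derive_replace_coord (f_smooth.1 (point s w)).
  apply: (is_derive_eq (is_deriveZ (v w) (is_deriveB df (is_derive_cst (f (X w)) s 1)))).
  by rewrite subr0.
- move=> w s; apply: cvgM; first exact: cvg_cst.
  by apply: cvgM; [exact: cvg_cst|exact: (continuous_replace_coord (@partial_continuous k))].
- by move=> w s; rewrite !normrM !ler_wpM2l// normr_partial_le.
- by rewrite gE; exact: integrable_weighted_increment.
- by rewrite g'E; exact: integrable_rvZ.
Qed.

End stein.

Section two_point.
Variables (sigma u : R) (alpha : 'I_m -> I) (p q : I).
Hypotheses (u_gt0 : 0 < u) (alpha_fresh : forall k, ~ S (alpha k))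
  (alpha_inj : injective alpha).
Hypothesis alpha_normal : forall k, standard_normal (xi (alpha k)).
Hypotheses (p_fresh : ~ S p) (q_fresh : ~ S q) (pq : p <> q).
Hypotheses (p_alpha : forall k, alpha k <> p) (q_alpha : forall k, alpha k <> q).
Hypotheses (p_noise : centered_noise P sigma (xi p))
  (q_noise : centered_noise P sigma (xi q)).
Local Notation Z := (xi_row xi alpha).

Definition two_point k (w : Omega) : R :=
  two_point_difference f u (X w) (Z w) (xi p w) (xi q w) * xi (alpha k) w.

Let slope (w : Omega) : R := (f (X w + u *: Z w) - f (X w - u *: Z w)) / (2 * u).

Let product_noise k (i : I) (w : Omega) : R := xi i w * xi (alpha k) w.

Lemma two_point_split k w : two_point k w =
  slope w * xi (alpha k) w + (2 * u)^-1 * (product_noise k p w - product_noise k q w).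
Proof. by rewrite /two_point /two_point_difference /slope /product_noise; ring. Qed.

Lemma slope_le w : `|slope w| <= G * norm2 (Z w).
Proof.
have u2_gt0 : 0 < 2 * u by rewrite mulr_gt0.
rewrite normrM normfV (gtr0_norm u2_gt0) ler_pdivrMr//.
apply: le_trans (f_lipschitz _ _) _.
rewrite (_ : X w + u *: Z w - _ = (2 * u) *: Z w) ?norm2Z ?gtr0_norm//; first by lra.
by rewrite opprB addrC subrKA -scalerDl -mulr2n mulr_natl.
Qed.

Lemma slope_measurable : measurable_fun setT slope.
Proof.
apply: measurable_funM => //; apply: (@known_measurable _ _ _ _ _ xi setT).
apply: measurable_funB; apply: (known_continuous f_continuous).
  by apply: known_rowD => //; exact: known_xi_row_setT.
under eq_fun do rewrite -scaleNr.
by apply: known_rowD => //; exact: known_xi_row_setT.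
Qed.

Let normal_sqr k : square_integrable P (xi (alpha k)).
Proof. exact: square_integrable_standard_normal (alpha_normal k). Qed.

Lemma product_noise_moment k i : alpha k <> i -> centered_noise P sigma (xi i) ->
  square_integrable P (product_noise k i) /\
  expect P (fun w => product_noise k i w ^+ 2) <= sigma ^+ 2.
Proof.
move=> ki [i_sqr _ i_le].
have [||||? ->] := square_integrable_indepM xi_indep (S := [set~ i]) (a := i)
  (Y := xi (alpha k)) => //.
- by apply.
- exact: known_xi.
by rewrite (standard_normal_second_moment (alpha_normal k)) mulr1.
Qed.

Lemma expect_product_noise_cross k :
  expect P (fun w => product_noise k p w * product_noise k q w) = 0.
Proof.
have [[p_sqr p0 _] [p_mom _]] := (p_noise, product_noise_moment (@p_alpha k) p_noise).
have [q_mom _] := product_noise_moment (@q_alpha k) q_noise.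
have prodE w : product_noise k p w * product_noise k q w =
    xi p w * (xi q w * xi (alpha k) w ^+ 2) by rewrite /product_noise; ring.
under [X in expect _ X]eq_fun do rewrite prodE.
apply: (expect_centered_mul xi_indep (S := [set~ p])) => //.
- by apply.
- apply: measurable_funM; first by apply: known_xi => /esym.
  by apply: measurable_funX; apply: known_xi; exact: p_alpha.
- exact: square_integrable_integrable.
- by under eq_fun do rewrite -prodE; exact: integrable_rvM.
Qed.

Lemma noise_difference_moment k :
  let noise w := (2 * u)^-1 * (product_noise k p w - product_noise k q w) in
  square_integrable P noise /\
  expect P (fun w => noise w ^+ 2) <= sigma ^+ 2 / (2 * u ^+ 2).
Proof.
have [p_sqr p_le] := product_noise_moment (@p_alpha k) p_noise.
have [q_sqr q_le] := product_noise_moment (@q_alpha k) q_noise.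
have [_ ip] := p_sqr; have [_ iq] := q_sqr; have ipq := integrable_rvM p_sqr q_sqr.
split; first by apply: square_integrableZ; exact: square_integrableB.
have sqrE w : ((2 * u)^-1 * (product_noise k p w - product_noise k q w)) ^+ 2 =
    (2 * u) ^- 2 * (product_noise k p w ^+ 2 + product_noise k q w ^+ 2
      - 2 * (product_noise k p w * product_noise k q w)).
  by rewrite exprMn exprVn; congr (_ * _); ring.
under [X in expect _ X]eq_fun do rewrite sqrE.
rewrite expectZ; last by apply: integrable_rvB; [exact: integrable_rvD|exact: integrable_rvZ].
rewrite expectB; [|exact: integrable_rvD|exact: integrable_rvZ].
rewrite expectD// expectZ// expect_product_noise_cross mulr0 subr0.
rewrite ler_pdivrMl ?exprn_gt0 ?mulr_gt0//.
rewrite (_ : _ * (_ / _) = 2 * sigma ^+ 2); last by field; rewrite gt_eqF.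
by rewrite mulr2n mulrDl mul1r lerD.
Qed.

Lemma slope_moment k :
  square_integrable P (fun w => slope w * xi (alpha k) w) /\
  expect P (fun w => (slope w * xi (alpha k) w) ^+ 2) <= 3 * G ^+ 2 * m%:R.
Proof.
have NZ_sqr := square_integrable_norm2M_xi_row alpha_normal k.
have GNZ_sqr := square_integrableZ G NZ_sqr.
have mslope : measurable_fun setT (fun w => slope w * xi (alpha k) w).
  by apply: measurable_funM => //; exact: slope_measurable.
have slopeM_le w : `|slope w * xi (alpha k) w| <= `|G * (norm2 (Z w) * xi (alpha k) w)|.
  rewrite mulrA normrM [leRHS]normrM ler_wpM2r//; apply: le_trans (slope_le w) _.
  by rewrite normrM (ger0_norm G_ge0) ler_wpM2l// ler_norm.
split; first exact: le_square_integrable mslope slopeM_le GNZ_sqr.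
apply: le_trans (expect_sqr_le mslope slopeM_le GNZ_sqr) _.
under [X in expect _ X]eq_fun do rewrite exprMn.
rewrite expectZ; last by have [] := NZ_sqr.
rewrite (_ : 3 * _ * _ = G ^+ 2 * (3 * m%:R)); last by ring.
by rewrite ler_wpM2l ?sqr_ge0// expect_sqr_norm2M_xi_row_le.
Qed.

Lemma known_two_point (S' : set I) k : S `<=` S' -> (forall l, S' (alpha l)) ->
  S' p -> S' q -> known xi S' (two_point k).
Proof.
move=> SS' S'alpha S'p S'q; have S'X := known_row_sub SS' SX.
have S'Z := known_xi_row S'alpha; apply: measurable_funM; last exact: known_xi.
apply: measurable_funM; last exact: measurable_cst.
apply: measurable_funB; (apply: measurable_funD; last exact: known_xi).
  by apply: (known_continuous f_continuous); exact: known_rowD.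
by apply: (known_continuous f_continuous); under eq_fun do rewrite -scaleNr; exact: known_rowD.
Qed.

(* The weights 5 and 5/4 leave the noise term dominant. *)
Lemma two_point_moment k : square_integrable P (two_point k) /\
  expect P (fun w => two_point k w ^+ 2) <= two_point_variance m G sigma u.
Proof.
have [slope_sqr slope_mom] := slope_moment k.
have [noise_sqr noise_mom] := noise_difference_moment k.
rewrite (funext (two_point_split k)); split; first exact: square_integrableD.
have := expect_sqrD_le (ltr0n R 4) slope_sqr noise_sqr; move=> /le_trans; apply.
have half_ratio : sigma ^+ 2 / (2 * u ^+ 2) = (sigma ^+ 2 / u ^+ 2) / 2.
  by field; rewrite gt_eqF.
by move: slope_mom noise_mom; rewrite /two_point_variance half_ratio; lra.
Qed.

Lemma expect_weighted_product_noise k i : ~ S i -> alpha k <> i ->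
  centered_noise P sigma (xi i) ->
  integrable_rv P (fun w => v w * product_noise k i w) /\
  expect P (fun w => v w * product_noise k i w) = 0.
Proof.
move=> i_fresh ki i_noise; have [i_sqr i0 _] := i_noise.
have [prod_sqr _] := product_noise_moment ki i_noise.
have iprod := square_integrable_integrable
  (square_integrableM_bounded (known_measurable Sv) v_le prod_sqr).
split=> //; have prodE w : v w * product_noise k i w = xi i w * (v w * xi (alpha k) w).
  by rewrite /product_noise mulrCA.
under [X in expect _ X]eq_fun do rewrite prodE.
apply: (expect_centered_mul xi_indep (S := [set~ i])) => //.
- by apply.
- apply: measurable_funM; last exact: known_xi.
  by apply: known_sub Sv => j Sj ji; apply: i_fresh; rewrite -ji.
- exact: square_integrable_integrable.
- by under eq_fun do rewrite -prodE.
Qed.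

Lemma expect_weighted_two_point k :
  integrable_rv P (fun w => v w * two_point k w) /\
  expect P (fun w => v w * two_point k w) =
  expect P (fun w => v w * smoothed_gradient f u (X w) (Z w) ord0 k).
Proof.
have [ip p0] := expect_weighted_product_noise p_fresh (@p_alpha k) p_noise.
have [iq q0] := expect_weighted_product_noise q_fresh (@q_alpha k) q_noise.
have iplus := integrable_weighted_increment alpha_normal k u.
have iminus := integrable_weighted_increment alpha_normal k (- u).
have splitE : (fun w => v w * two_point k w) = fun w => (2 * u)^-1 *
    ((v w * (xi (alpha k) w * increment alpha u w) -
      v w * (xi (alpha k) w * increment alpha (- u) w)) +
     (v w * product_noise k p w - v w * product_noise k q w)).
  by apply/funext => w; rewrite two_point_split /slope /increment scaleNr; ring.
have isignal := integrable_rvB iplus iminus; have inoise := integrable_rvB ip iq.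
rewrite splitE; split; first by apply: integrable_rvZ; exact: integrable_rvD.
rewrite expectZ; last exact: integrable_rvD.
rewrite expectD// !expectB// p0 q0 !stein_increment//.
have [_ ->] := expect_weighted_smoothed_gradient k u (known_xi_row_setT alpha).
by move: (expect _ _) (expect _ _) => a b; field; rewrite gt_eqF.
Qed.

End two_point.

End perturbed_gradient.

(** * Descent along stale estimates *)

Section stale_descent.
Context {d : measure_display} {Omega : measurableType d} {R : realType}
  {P : probability Omega R} {n : nat} {dim : 'I_n -> nat}.
Variables (G L sigma u eta : R) (f : 'I_n -> profile R dim -> R).
Hypotheses (fP : problem G L f) (n_gt0 : (0 < n)%N).
Hypotheses (G_ge0 : 0 <= G) (L_ge0 : 0 <= L) (u_gt0 : 0 < u) (eta_gt0 : 0 < eta).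
Variables (z : forall i : 'I_n, nat -> 'I_(dim i) -> {RV P >-> R})
  (noiseP noiseM : 'I_n -> nat -> {RV P >-> R}).
Hypothesis rand : zfo_randomness z noiseP noiseM sigma.
Local Notation D := (\sum_i dim i)%N.
Local Notation idx := (nat * ({i : 'I_n & 'I_(dim i)} + ('I_n + 'I_n)))%type.
Local Notation xi := (primitive_variable z noiseP noiseM).
Local Notation Ex := (expect P).
Local Notation F := (objective f).
Local Notation own k := (tagnat.sig1 k).
Local Notation variance := (two_point_variance D G sigma u).

Definition coords (t : nat) (k : 'I_D) : idx := (t, inl (tagnat.sig k)).

Definition noise_index (t : nat) (a : 'I_n + 'I_n) : idx := (t, inr a).

Definition past (t : nat) : set idx := [set b | (b.1 < t)%N].

Local Notation Z t := (xi_row xi (coords t)).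

Let xi_indep : mutually_independent xi := rand_indep rand.

Lemma coords_eq t s k l : coords t k = coords s l -> k = l.
Proof. by move=> [_ /(can_inj tagnat.sigK)]. Qed.

Lemma coords_inj t : injective (coords t).
Proof. by move=> k l /coords_eq. Qed.

Lemma coords_normal t k : standard_normal (xi (coords t k)).
Proof. by move=> A mA; exact: (rand_gaussian rand). Qed.

Lemma noise_centered t a : centered_noise P sigma (xi (noise_index t a)).
Proof.
case: a => j; apply: centered_noise_of_variance.
- exact: (rand_meanP rand).
- exact: (rand_varP rand).
- exact: (rand_meanM rand).
- exact: (rand_varM rand).
Qed.

Lemma coords_neq_noise t k a : coords t k <> noise_index t a.
Proof. by []. Qed.

Lemma not_past t s a : (t <= s)%N -> ~ past t (s, a).
Proof. by rewrite leqNgt => /negP. Qed.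

Lemma past_sub t s : (t <= s)%N -> past t `<=` past s.
Proof. by move=> ts b bt; exact: leq_trans bt ts. Qed.

Variables (X : nat -> Omega -> profile R dim) (x0 : profile R dim).
Variable tau : nat -> 'I_n -> 'I_n -> int.
Hypothesis tau_le : forall t i j, tau t i j <= t%:Z.
Hypothesis X_init : forall w, X 0 w = x0.

Definition sample (j : 'I_n) (k : 'I_D) (t : nat) : Omega -> R :=
  two_point xi (f j) (X t) u (coords t) (noise_index t (inl j)) (noise_index t (inr j)) k.

Definition stamped_sample (j : 'I_n) (k : 'I_D) (s : int) (w : Omega) : R :=
  at_stamp (fun r => sample j k r w) s.

Definition estimate (t : nat) (w : Omega) : profile R dim :=
  \row_k (n%:R^-1 * \sum_j stamped_sample j k (tau t (own k) j) w).

Hypothesis X_step : forall t w, X t.+1 w = X t w - eta *: estimate t w.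

Lemma iterate_known t : known_row xi (past t) (X t).
Proof.
elim/ltn_ind: t => -[|t] IH k; rewrite /known.
  by under [X in measurable_fun _ X]eq_fun do rewrite X_init; exact: measurable_cst.
under [X in measurable_fun _ X]eq_fun do rewrite X_step !mxE.
have IHt : known_row xi (past t.+1) (X t) by exact: known_row_sub (past_sub (leqnSn t)) (IH _ _).
apply: measurable_funB; first exact: IHt.
apply: measurable_funM; first exact: measurable_cst.
apply: measurable_funM; first exact: measurable_cst.
apply: measurable_sum => j; rewrite /stamped_sample.
have := tau_le t (own k) j; case: (tau t _ j) => [s|s] /= st; last exact: measurable_cst.
rewrite lez_nat in st.
apply: (known_two_point (cost_lipschitz fP j) (IH s st)); do ?[exact: st|by move=> l].
exact: past_sub (leqW st).
Qed.

Lemma iterate_setT t : known_row xi setT (X t).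
Proof. exact: known_row_sub (@subsetT _ (past t)) (@iterate_known t). Qed.

Lemma measurable_iterate_fun t (g : profile R dim -> R) :
  continuous g -> measurable_fun setT (fun w => g (X t w)).
Proof.
move=> cg; apply: (@known_measurable _ _ _ _ _ xi setT).
exact: (known_continuous cg (@iterate_setT t)).
Qed.

Lemma sample_moment j k t : square_integrable P (sample j k t) /\
  Ex (fun w => sample j k t w ^+ 2) <= variance.
Proof.
apply: (two_point_moment xi_indep G_ge0 (cost_lipschitz fP j) (@iterate_known t)) => //.
- exact: coords_normal.
- exact: noise_centered.
- exact: noise_centered.
Qed.

Lemma stamped_sample_moment j k (s : int) : square_integrable P (stamped_sample j k s) /\
  Ex (fun w => stamped_sample j k s w ^+ 2) <= variance.
Proof.
case: s => s; first exact: sample_moment.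
split; first exact: square_integrable_cst.
under [X in expect _ X]eq_fun do rewrite /stamped_sample /= expr0n.
by rewrite expect_cst two_point_variance_ge0.
Qed.

Lemma estimate_coord_moment t k : square_integrable P (fun w => estimate t w ord0 k) /\
  Ex (fun w => estimate t w ord0 k ^+ 2) <= variance.
Proof.
pose a j := stamped_sample j k (tau t (own k) j).
have a_sqr j : square_integrable P (a j) by have [] := stamped_sample_moment j k (tau t (own k) j).
have estimateE w : estimate t w ord0 k = n%:R^-1 * \sum_j a j w by rewrite mxE.
have e_sqr : square_integrable P (fun w => estimate t w ord0 k).
  rewrite (funext estimateE); apply: square_integrableZ.
  by apply: square_integrable_sum => j _; exact: a_sqr.
have ia j : integrable_rv P (fun w => a j w ^+ 2) by have [] := a_sqr j.
have isum : integrable_rv P (fun w => \sum_j a j w ^+ 2) by exact: integrable_rv_sum.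
split=> //; apply: (@le_trans _ _ (Ex (fun w => n%:R^-1 * \sum_j a j w ^+ 2))).
  apply: expect_le; [by have [] := e_sqr|exact: integrable_rvZ|].
  by move=> w; rewrite estimateE sqr_mean_le.
rewrite expectZ// expect_sum//; apply: mean_le (two_point_variance_ge0 _ _ _ _) _ => j.
by have [] := stamped_sample_moment j k (tau t (own k) j).
Qed.

Lemma norm2_estimate_moment t : square_integrable P (fun w => norm2 (estimate t w)) /\
  Ex (fun w => norm2 (estimate t w) ^+ 2) <= D%:R * variance.
Proof.
have [e_sqr] := root_sum_sqr_moment predT
  (fun k => (estimate_coord_moment t k).1) (fun k => (estimate_coord_moment t k).2).
by rewrite card_ord; split.
Qed.

Definition block_norm (i j : 'I_n) (s : nat) (w : Omega) : R :=
  Num.sqrt (\sum_(k | own k == i) sample j k s w ^+ 2).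

Definition block_size (i : 'I_n) : nat := #|[pred k : 'I_D | own k == i]|.

Lemma block_norm_moment i j s : square_integrable P (block_norm i j s) /\
  Ex (fun w => block_norm i j s w ^+ 2) <= (block_size i)%:R * variance.
Proof.
exact: (root_sum_sqr_moment (fun k => own k == i)
  (fun k => (sample_moment j k s).1) (fun k => (sample_moment j k s).2)).
Qed.

Lemma sum_block_size : \sum_i (block_size i)%:R = D%:R :> R.
Proof.
rewrite -natr_sum; congr (_%:R).
rewrite -[RHS]card_ord -sum1_card (partition_big (fun k : 'I_D => own k) predT)//=.
by apply: eq_bigr => i _; rewrite sum1_card.
Qed.

Lemma drift_le s t w : (s <= t)%N ->
  norm2 (X t w - X s w) <= eta * \sum_(s <= r < t) norm2 (estimate r w).
Proof.
move=> st; rewrite -(subnKC st); elim: (t - s)%N => [|p IH].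
  by rewrite addn0 subrr norm2_0 big_geq// mulr0.
rewrite addnS big_nat_recr ?leq_addr//= mulrDr X_step addrAC.
apply: le_trans (norm2D _ _) _; rewrite norm2N norm2Z (gtr0_norm eta_gt0).
by rewrite lerD2r.
Qed.

Lemma drift_square_integrable s t : (s <= t)%N ->
  square_integrable P (fun w => norm2 (X t w - X s w)).
Proof.
move=> st; have path_sqr : square_integrable P
    (fun w => eta * \sum_(s <= r < t) norm2 (estimate r w)).
  apply: square_integrableZ; apply: square_integrable_sum => r _.
  by have [] := norm2_estimate_moment r.
apply: le_square_integrable path_sqr => [|w].
  apply: (@known_measurable _ _ _ _ _ xi setT).
  apply: (known_continuous (lipschitz2_continuous lipschitz2_norm2)).
  under [X in known_row _ _ X]eq_fun do rewrite -scaleN1r.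
  exact: known_rowD (@iterate_setT t) (@iterate_setT s).
rewrite ger0_norm ?norm2_ge0// (le_trans (drift_le w st))//; exact: ler_norm.
Qed.

Lemma expect_drift_mul_le (Y : Omega -> R) s t : (s <= t)%N ->
  square_integrable P Y -> (forall w, 0 <= Y w) ->
  Ex (fun w => norm2 (X t w - X s w) * Y w) <=
  eta * (t - s)%:R *
    (Num.sqrt (D%:R * variance) * Num.sqrt (Ex (fun w => Y w ^+ 2))).
Proof.
move=> st sY Y_ge0; have sE r : square_integrable P (fun w => norm2 (estimate r w)).
  by have [] := norm2_estimate_moment r.
have iE r : integrable_rv P (fun w => norm2 (estimate r w) * Y w) by exact: integrable_rvM.
have iS : integrable_rv P (fun w => \sum_(s <= r < t) norm2 (estimate r w) * Y w).
  exact: integrable_rv_sum.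
apply: (@le_trans _ _ (Ex (fun w => eta * \sum_(s <= r < t) norm2 (estimate r w) * Y w))).
  apply: expect_le; [|exact: integrable_rvZ|].
  - by apply: integrable_rvM => //; exact: drift_square_integrable.
  - by move=> w; rewrite -mulr_suml mulrA ler_wpM2r// drift_le.
rewrite expectZ// -mulrA ler_pM2l// expect_sum// mulr_natl -sumr_const_nat.
apply: ler_sum => r _; have [_ eE] := norm2_estimate_moment r.
apply: le_trans (ler_norm _) _; apply: le_trans (expect_cauchy_schwarz (sE r) sY) _.
by rewrite ler_wpM2r ?sqrtr_ge0// ler_wsqrtr.
Qed.

Lemma expect_drift_le s t : (s <= t)%N ->
  Ex (fun w => norm2 (X t w - X s w)) <= eta * (t - s)%:R * Num.sqrt (D%:R * variance).
Proof.
move=> st; have := expect_drift_mul_le st (square_integrable_cst P 1) (fun=> ler01).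
under [X in expect _ X <= _]eq_fun do rewrite mulr1.
under [X in _ * Num.sqrt (expect _ X)]eq_fun do rewrite expr1n.
by rewrite expect_cst sqrtr1 mulr1.
Qed.

Lemma objective_gradient_le x : norm2 (gradient F x) <= G.
Proof.
apply: norm2_gradient_le => //; first exact: objective_lipschitz fP G_ge0.
exact: objective_differentiable fP x.
Qed.

Lemma objective_integrable t : integrable_rv P (fun w => F (X t w)).
Proof.
have drift_sqr := drift_square_integrable (leq0n t).
have bound : integrable_rv P (fun w => `|F x0| + G * norm2 (X t w - X 0 w)).
  apply: integrable_rvD; first exact: integrable_rv_cst.
  by apply: integrable_rvZ; exact: square_integrable_integrable.
apply: le_integrable_rv bound => [|w].
  apply: measurable_iterate_fun; apply: lipschitz2_continuous.
  exact: objective_lipschitz fP G_ge0.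
rewrite -(X_init w) -{1}(subrK (F (X 0 w)) (F (X t w))) addrC.
apply: le_trans (ler_normD _ _) _.
by rewrite lerD2l (objective_lipschitz fP G_ge0).
Qed.

Lemma expect_objective_le t :
  Ex (fun w => F (X t w)) <= F x0 + G * (eta * t%:R * Num.sqrt (D%:R * variance)).
Proof.
have idrift := square_integrable_integrable (drift_square_integrable (leq0n t)).
have := ler_wpM2l G_ge0 (expect_drift_le (leq0n t)); rewrite subn0 => drift_mean.
rewrite -lerBlDl; apply: le_trans drift_mean.
rewrite -[X in _ - X](expect_cst P) -expectZ// -expectB; last exact: integrable_rv_cst.
  apply: expect_le; [|exact: integrable_rvZ|].
  - by apply: integrable_rvB; [exact: objective_integrable|exact: integrable_rv_cst].
  - move=> w; rewrite -(X_init w); apply: le_trans (ler_norm _) _.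
    exact: (objective_lipschitz fP G_ge0).
exact: objective_integrable.
Qed.

Lemma infimum_le_expect t : infimum F <= Ex (fun w => F (X t w)).
Proof.
rewrite -[leLHS](expect_cst P); apply: expect_le.
- exact: integrable_rv_cst.
- exact: objective_integrable.
- by move=> w; exact: infimum_le fP _.
Qed.

Lemma sqr_gradient_integrable t :
  integrable_rv P (fun w => norm2 (gradient F (X t w)) ^+ 2).
Proof.
apply: (le_integrable_rv _ _ (integrable_rv_cst P (G ^+ 2))) => [|w].
  apply: measurable_funX; apply: (@known_measurable _ _ _ _ _ xi setT).
  apply: measurable_continuous_row => [k|].
    exact: (known_continuous (lipschitz2_continuous
      (lipschitz2_partial k (objective_smooth fP L_ge0))) (@iterate_setT t)).
  exact: lipschitz2_continuous lipschitz2_norm2.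
by rewrite ger0_norm ?sqr_ge0// ler_sqr ?nnegrE ?norm2_ge0 ?objective_gradient_le.
Qed.

Lemma objective_partial_known s k : known xi (past s) (fun w => gradient F (X s w) ord0 k).
Proof.
exact: (known_continuous (lipschitz2_continuous
  (lipschitz2_partial k (objective_smooth fP L_ge0))) (@iterate_known s)).
Qed.

Lemma normr_objective_partial_le x k : `|gradient F x ord0 k| <= G.
Proof. exact: le_trans (coord_le_norm2 _ _) (objective_gradient_le x). Qed.

(* [Z s] is exchanged for [Z t], so that the smoothing biases of all the
   coordinates refer to the same point. *)
Lemma expect_gradient_sample j k s t : (s <= t)%N ->
  [/\ integrable_rv P (fun w => gradient F (X s w) ord0 k * sample j k s w),
      integrable_rv P (fun w => gradient F (X s w) ord0 k *
        smoothed_gradient (f j) u (X s w) (Z t w) ord0 k) &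
      Ex (fun w => gradient F (X s w) ord0 k * sample j k s w) =
      Ex (fun w => gradient F (X s w) ord0 k *
        smoothed_gradient (f j) u (X s w) (Z t w) ord0 k)].
Proof.
move=> st; have fj := (cost_lipschitz fP j, cost_smooth fP j).
have partial_s w : `|gradient F (X s w) ord0 k| <= G by exact: normr_objective_partial_le.
have [isample sampleE] := expect_weighted_two_point xi_indep G_ge0 fj.1 fj.2
  (@iterate_known s) (@objective_partial_known s k) partial_s u_gt0
  (fun l => @not_past s s _ (leqnn s)) (@coords_inj s) (@coords_normal s)
  (@not_past s s _ (leqnn s)) (@not_past s s _ (leqnn s))
  (p := noise_index s (inl j)) (q := noise_index s (inr j))
  (fun l => @coords_neq_noise s l (inl j)) (fun l => @coords_neq_noise s l (inr j))
  (noise_centered s (inl j)) (noise_centered s (inr j)) k.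
have [ismooth _] := expect_weighted_smoothed_gradient G_ge0 fj.1 fj.2 (@iterate_known s)
  (@objective_partial_known s k) partial_s k u (known_xi_row_setT (coords t)).
split; [exact: isample|exact: ismooth|]; apply: etrans sampleE _.
apply: (exchange_smoothed_gradient xi_indep G_ge0 fj.1 fj.2 (@iterate_known s)
  (@objective_partial_known s k) partial_s).
- by move=> l; exact: not_past.
- by move=> l; exact: not_past.
- exact: coords_inj.
- exact: coords_inj.
- exact: coords_eq.
- by move=> l A mA; apply: etrans (coords_normal s l mA) (esym (coords_normal t l mA)).
Qed.

Lemma sum_blocks (g : 'I_D -> 'I_n -> R) :
  \sum_k \sum_j g k j = \sum_i \sum_j \sum_(k | own k == i) g k j.
Proof.
rewrite (partition_big (fun k : 'I_D => own k) predT)//=.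
by apply: eq_bigr => i _; rewrite exchange_big.
Qed.

Section one_step.
Variables (t : nat) (stamp b : 'I_n -> 'I_n -> nat).
Hypothesis tauE : forall i j, tau t i j = (stamp i j)%:Z.
Hypothesis stamp_delay : forall i j, (t - stamp i j <= b i j)%N.

Let stamp_past i j : (stamp i j <= t)%N.
Proof. by have := tau_le t i j; rewrite tauE lez_nat. Qed.

Let drift i j w : R := norm2 (X t w - X (stamp i j) w).

Let stale k j w : R :=
  (gradient F (X t w) - gradient F (X (stamp (own k) j) w)) ord0 k *
  sample j k (stamp (own k) j) w.

Let fresh k j w : R :=
  gradient F (X (stamp (own k) j) w) ord0 k *
  smoothed_gradient (f j) u (X (stamp (own k) j) w) (Z t w) ord0 k.

Definition delay_loss i j (w : Omega) : R :=
  L * (drift i j w * block_norm i j (stamp i j) w) + 2 * G * L * drift i j w.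

Lemma stale_fresh_ge w :
  n%:R * (7 / 8 * norm2 (gradient F (X t w)) ^+ 2
          - 2 * L ^+ 2 * u ^+ 2 * norm2 (Z t w) ^+ 2)
    - \sum_i \sum_j delay_loss i j w <= \sum_k \sum_j (stale k j w + fresh k j w).
Proof.
apply: le_trans (lerB (smoothed_alignment fP u _ _ n_gt0) (lexx _)) _.
rewrite /dot exchange_big /= !sum_blocks -sumrB; apply: ler_sum => i _.
rewrite -sumrB; apply: ler_sum => j _.
have [_ F_smooth] := objective_smooth fP L_ge0.
have cost_gradient_le y : norm2 (gradient (f j) y) <= G.
  apply: norm2_gradient_le => //; first exact: cost_lipschitz fP j.
  by have [] := cost_smooth fP j.
have := partial_dot_stale_ge (fun k => own k == i) (fun k => sample j k (stamp i j) w)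
  (F_smooth (X t w) (X (stamp i j) w))
  (smoothed_gradient_lipschitz u (X t w) (X (stamp i j) w) (Z t w) (cost_smooth fP j))
  (objective_gradient_le (X (stamp i j) w))
  (norm2_smoothed_gradient_le u (X t w) (Z t w) cost_gradient_le).
rewrite -/(drift i j w) -[Num.sqrt _]/(block_norm i j (stamp i j) w).
rewrite /delay_loss (mulrA L) (mulrA (2 * G)) => /le_trans; apply.
by apply: ler_sum => k /eqP ki; rewrite /stale /fresh ki.
Qed.

Let stale_integrable k j : integrable_rv P (stale k j).
Proof.
apply: square_integrable_integrable.
apply: (@square_integrableM_bounded _ _ _ _ (G + G)) => [|w|].
- under [X in measurable_fun _ X]eq_fun do rewrite coordB.
  by apply: measurable_funB; exact: known_measurable (@objective_partial_known _ k).
- rewrite coordB; apply: le_trans (ler_normB _ _) _.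
  by apply: lerD; exact: normr_objective_partial_le.
- by have [] := sample_moment j k (stamp (own k) j).
Qed.

Lemma estimate_dotE w : n%:R * dot (gradient F (X t w)) (estimate t w) =
  \sum_k \sum_j (stale k j w +
    gradient F (X (stamp (own k) j) w) ord0 k * sample j k (stamp (own k) j) w).
Proof.
rewrite /dot mulr_sumr; apply: eq_bigr => k _.
rewrite [estimate t w ord0 k]mxE mulrCA mulVKf ?pnatr_eq0 -?lt0n// mulr_sumr.
by apply: eq_bigr => j _; rewrite tauE /stale -mulrDl coordB subrK.
Qed.

Lemma expect_estimate_dot :
  integrable_rv P (fun w => dot (gradient F (X t w)) (estimate t w)) /\
  n%:R * Ex (fun w => dot (gradient F (X t w)) (estimate t w)) =
  Ex (fun w => \sum_k \sum_j (stale k j w + fresh k j w)).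
Proof.
have n_neq0 : n%:R != 0 :> R by rewrite pnatr_eq0 -lt0n.
have dotE w : dot (gradient F (X t w)) (estimate t w) = n%:R^-1 *
    \sum_k \sum_j (stale k j w +
      gradient F (X (stamp (own k) j) w) ord0 k * sample j k (stamp (own k) j) w).
  by rewrite -estimate_dotE mulKf.
have iterm k j : integrable_rv P (fun w => stale k j w +
    gradient F (X (stamp (own k) j) w) ord0 k * sample j k (stamp (own k) j) w).
  by apply: integrable_rvD => //; have [] := expect_gradient_sample j k (stamp_past (own k) j).
have irow k := integrable_rv_sum (index_enum 'I_n) (fun j (_ : true) => iterm k j).
have isum := integrable_rv_sum (index_enum 'I_D) (fun k (_ : true) => irow k).
have ifresh k j : integrable_rv P (fun w => stale k j w + fresh k j w).
  by apply: integrable_rvD => //; have [] := expect_gradient_sample j k (stamp_past (own k) j).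
have ifrow k := integrable_rv_sum (index_enum 'I_n) (fun j (_ : true) => ifresh k j).
rewrite (funext dotE); split; first exact: integrable_rvZ.
rewrite expectZ// mulVKf//.
rewrite (expect_sum _ (fun k _ => irow k)) (expect_sum _ (fun k _ => ifrow k)).
apply: eq_bigr => k _; rewrite (expect_sum _ (fun j _ => iterm k j)).
rewrite (expect_sum _ (fun j _ => ifresh k j)); apply: eq_bigr => j _.
by have [iA iB AB] := expect_gradient_sample j k (stamp_past (own k) j); rewrite !expectD// AB.
Qed.

Definition delay_loss_bound i j : R :=
  L * (eta * (b i j)%:R *
    (Num.sqrt (D%:R * variance) * Num.sqrt ((block_size i)%:R * variance))) +
  2 * G * L * (eta * (b i j)%:R * Num.sqrt (D%:R * variance)).

Lemma expect_delay_loss_le i j : integrable_rv P (delay_loss i j) /\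
  Ex (delay_loss i j) <= delay_loss_bound i j.
Proof.
have [block_sqr block_le] := block_norm_moment i j (stamp i j).
have drift_sqr : square_integrable P (drift i j) by exact: drift_square_integrable.
have iblock := integrable_rvM drift_sqr block_sqr.
have idrift := square_integrable_integrable drift_sqr.
split; first by apply: integrable_rvD; exact: integrable_rvZ.
rewrite expectD; [|exact: integrable_rvZ..].
have delay_le (c : R) : 0 <= c ->
    eta * (t - stamp i j)%:R * c <= eta * (b i j)%:R * c.
  by move=> c_ge0; rewrite ler_wpM2r// ler_wpM2l ?(ltW eta_gt0)// ler_nat.
rewrite !expectZ// lerD// ler_wpM2l ?mulr_ge0//.
- apply: le_trans (expect_drift_mul_le (stamp_past i j) block_sqr (fun=> sqrtr_ge0 _)) _.
  apply: le_trans (delay_le _ _) _; first by rewrite mulr_ge0 ?sqrtr_ge0.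
  by rewrite !ler_wpM2l ?mulr_ge0 ?sqrtr_ge0 ?(ltW eta_gt0)// ler_wsqrtr.
- apply: le_trans (expect_drift_le (stamp_past i j)) _.
  by rewrite delay_le ?sqrtr_ge0.
Qed.

Definition delay_error : R := n%:R^-1 * \sum_i \sum_j delay_loss_bound i j.

Lemma expected_alignment :
  7 / 8 * Ex (fun w => norm2 (gradient F (X t w)) ^+ 2) <=
  Ex (fun w => dot (gradient F (X t w)) (estimate t w)) +
    2 * L ^+ 2 * u ^+ 2 * D%:R + delay_error.
Proof.
have n_pos : 0 < n%:R :> R by rewrite ltr0n.
have [_ dotE] := expect_estimate_dot.
have igrad := sqr_gradient_integrable t.
have [[_ iZ] Z_le] := norm2_xi_row_moment (@coords_normal t).
have iloss i j := (expect_delay_loss_le i j).1.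
have ilrow i := integrable_rv_sum (index_enum 'I_n) (fun j (_ : true) => iloss i j).
have ilsum := integrable_rv_sum (index_enum 'I_n) (fun i (_ : true) => ilrow i).
have loss_le : Ex (fun w => \sum_i \sum_j delay_loss i j w) <= n%:R * delay_error.
  rewrite mulVKf ?gt_eqF// (expect_sum _ (fun i _ => ilrow i)); apply: ler_sum => i _.
  rewrite (expect_sum _ (fun j _ => iloss i j)); apply: ler_sum => j _.
  by have [] := expect_delay_loss_le i j.
have ifresh : integrable_rv P (fun w => \sum_k \sum_j (stale k j w + fresh k j w)).
  apply: integrable_rv_sum => k _; apply: integrable_rv_sum => j _.
  by apply: integrable_rvD => //; have [] := expect_gradient_sample j k (stamp_past (own k) j).
have iterms : integrable_rv P (fun w => 7 / 8 * norm2 (gradient F (X t w)) ^+ 2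
    - 2 * L ^+ 2 * u ^+ 2 * norm2 (Z t w) ^+ 2).
  by apply: integrable_rvB; exact: integrable_rvZ.
have := expect_le (integrable_rvB (integrable_rvZ n%:R iterms) ilsum) ifresh stale_fresh_ge.
rewrite -dotE expectB//; last exact: integrable_rvZ.
rewrite expectZ// expectB; [|exact: integrable_rvZ..]; rewrite !expectZ// => ge.
have noise_le := ler_wpM2l (mulr_ge0 (mulr_ge0 (ler0n R 2) (sqr_ge0 L)) (sqr_ge0 u)) Z_le.
rewrite -(ler_pM2l n_pos); move: (ler_wpM2l (ltW n_pos) noise_le) loss_le ge; lra.
Qed.

Definition descent_error : R :=
  L / 2 * eta * (D%:R * variance) + 2 * L ^+ 2 * u ^+ 2 * D%:R + delay_error.

Lemma expected_descent :
  7 / 8 * Ex (fun w => norm2 (gradient F (X t w)) ^+ 2) <=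
  (Ex (fun w => F (X t w)) - Ex (fun w => F (X t.+1 w))) / eta + descent_error.
Proof.
have [idot _] := expect_estimate_dot; have alignment := expected_alignment.
have [[_ iest] est_le] := norm2_estimate_moment t.
have iF := objective_integrable t; have iF' := objective_integrable t.+1.
have descent : Ex (fun w => F (X t.+1 w)) <= Ex (fun w => F (X t w))
    - eta * Ex (fun w => dot (gradient F (X t w)) (estimate t w))
    + L / 2 * eta ^+ 2 * Ex (fun w => norm2 (estimate t w) ^+ 2).
  rewrite -!expectZ// -expectB//; last exact: integrable_rvZ.
  have idiff := integrable_rvB iF (integrable_rvZ eta idot).
  rewrite -expectD//; last exact: integrable_rvZ.
  apply: expect_le; [by []|by apply: integrable_rvD => //; exact: integrable_rvZ|].
  move=> w; rewrite X_step -scaleNr.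
  apply: le_trans (smooth_descent _ _ (objective_smooth fP L_ge0)) _.
  by rewrite norm2Z normrN (gtr0_norm eta_gt0) exprMn mulrA dotZr mulNr.
have quad_le : L / 2 * eta ^+ 2 * Ex (fun w => norm2 (estimate t w) ^+ 2) <=
    eta * (L / 2 * eta * (D%:R * variance)).
  rewrite (_ : eta * _ = L / 2 * eta ^+ 2 * (D%:R * variance)); last by ring.
  by rewrite ler_wpM2l// mulr_ge0 ?sqr_ge0// divr_ge0.
have dot_le : Ex (fun w => dot (gradient F (X t w)) (estimate t w)) <=
    (Ex (fun w => F (X t w)) - Ex (fun w => F (X t.+1 w))) / eta
    + L / 2 * eta * (D%:R * variance).
  by rewrite -lerBlDr ler_pdivlMr//; move: descent quad_le; lra.
by move: alignment dot_le; rewrite /descent_error; lra.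
Qed.

End one_step.

Lemma telescoped_descent (B T : nat) (b : 'I_n -> 'I_n -> nat) : (B <= T)%N ->
  (forall t i j, (B <= t)%N -> exists2 s : nat, tau t i j = s%:Z & (t - s <= b i j)%N) ->
  7 / 8 * \sum_(B <= t < T.+1) Ex (fun w => norm2 (gradient F (X t w)) ^+ 2) <=
  (F x0 - infimum F + G * (eta * B%:R * Num.sqrt (D%:R * variance))) / eta +
  (T - B + 1)%:R * descent_error b.
Proof.
move=> BT delay; pose value t := Ex (fun w => F (X t w)).
have step t : (B <= t)%N -> 7 / 8 * Ex (fun w => norm2 (gradient F (X t w)) ^+ 2) <=
    (value t - value t.+1) / eta + descent_error b.
  move=> Bt; apply: (@expected_descent t (fun i j => `|tau t i j|%N) b) => i j;
    by have [s -> ts] := delay t i j Bt.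
apply: (@le_trans _ _ (\sum_(B <= t < T.+1) ((value t - value t.+1) / eta + descent_error b))).
  rewrite mulr_sumr big_nat_cond [leRHS]big_nat_cond.
  by apply: ler_sum => t /andP[/andP[Bt _] _]; exact: step.
rewrite big_split /= sumr_const_nat -[descent_error b *+ _]mulr_natl subSn// addn1 lerD2r.
rewrite -mulr_suml ler_pM2r ?invr_gt0//.
have -> : \sum_(B <= t < T.+1) (value t - value t.+1) = value B - value T.+1.
  rewrite -[RHS]opprB -telescope_sumr ?leqW// -sumrN.
  by apply: eq_bigr => t _; rewrite opprB.
have := expect_objective_le B; have := infimum_le_expect T.+1.
by rewrite -/(value B) -/(value T.+1); lra.
Qed.

Lemma delay_errorE (b : 'I_n -> 'I_n -> nat) : delay_error b =
  L * eta * variance * Num.sqrt D%:R *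
    (n%:R^-1 * \sum_i \sum_j (b i j)%:R * Num.sqrt (block_size i)%:R) +
  2 * G * L * (eta * Num.sqrt (D%:R * variance)) *
    (n%:R^-1 * \sum_i \sum_j (b i j)%:R).
Proof.
rewrite /delay_error ![_ * (n%:R^-1 * _)]mulrCA -mulrDr; congr (_ * _).
rewrite !mulr_sumr -big_split; apply: eq_bigr => i _ /=.
rewrite !mulr_sumr -big_split; apply: eq_bigr => j _ /=.
have variance_ge0 := two_point_variance_ge0 D G sigma u.
rewrite /delay_loss_bound !sqrtrM// -[in X in _ = X + _](sqr_sqrtr variance_ge0).
by ring.
Qed.

Lemma sum_delay_block_le (b : 'I_n -> 'I_n -> nat) :
  \sum_i \sum_j (b i j)%:R * Num.sqrt (block_size i)%:R <=
  Num.sqrt (\sum_i \sum_j (b i j)%:R ^+ 2) * Num.sqrt (n%:R * D%:R) :> R.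
Proof.
rewrite !pair_bigA /=; apply: le_trans (ler_norm _) _.
apply: le_trans (cauchy_schwarz_sum _ _ _) _.
rewrite ler_wpM2l ?sqrtr_ge0// ler_wsqrtr//.
rewrite -(pair_bigA _ (fun i _ : 'I_n => Num.sqrt (block_size i)%:R ^+ 2)) /=.
rewrite -sum_block_size mulr_sumr; apply: ler_sum => i _.
by rewrite sumr_const card_ord sqr_sqrtr// mulr_natl.
Qed.

Lemma delay_error_le (b : 'I_n -> 'I_n -> nat) (B : nat) :
  (forall i j, (b i j <= B)%N) ->
  delay_error b <=
  L * eta * variance * D%:R *
    (Num.sqrt ((\sum_i \sum_j (b i j)%:R ^+ 2) / n%:R ^+ 2) * Num.sqrt n%:R)
  + 2 * G * L * (n%:R * B%:R) * (eta * Num.sqrt (D%:R * variance)).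
Proof.
move=> bB; have n_pos : 0 < n%:R :> R by rewrite ltr0n.
have bbarE : Num.sqrt ((\sum_i \sum_j (b i j)%:R ^+ 2) / n%:R ^+ 2) =
    n%:R^-1 * Num.sqrt (\sum_i \sum_j (b i j)%:R ^+ 2) :> R.
  by rewrite mulrC sqrtrM ?invr_ge0 ?sqr_ge0// sqrtrV ?sqr_ge0// sqrtr_sqr gtr0_norm.
rewrite delay_errorE bbarE; apply: lerD.
  have sqrtD := sqr_sqrtr (ler0n R D).
  rewrite [leRHS](_ : _ = L * eta * variance * Num.sqrt D%:R * (n%:R^-1 *
    (Num.sqrt (\sum_i \sum_j (b i j)%:R ^+ 2) * Num.sqrt (n%:R * D%:R)))).
    by rewrite !ler_wpM2l ?mulr_ge0 ?invr_ge0 ?sqrtr_ge0 ?two_point_variance_ge0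
      ?(ltW eta_gt0)// sum_delay_block_le.
  by rewrite sqrtrM// -{1}sqrtD; ring.
rewrite [leRHS](_ : _ =
    2 * G * L * (eta * Num.sqrt (D%:R * variance)) * (n%:R * B%:R)); last by ring.
rewrite ler_wpM2l ?mulr_ge0 ?sqrtr_ge0 ?(ltW eta_gt0)//.
apply: mean_le => [|i]; first by rewrite mulr_ge0.
rewrite mulr_natl -[X in _ *+ X]card_ord -sumr_const.
by apply: ler_sum => j _; rewrite ler_nat.
Qed.

End stale_descent.

(** * Arithmetic of the rate *)

Section rate.
Context {R : realType}.
Variables (L sigma u eta eps q D K : R).
Hypotheses (L_gt0 : 0 < L) (sigma_gt0 : 0 < sigma) (u_gt0 : 0 < u)
  (eta_gt0 : 0 < eta) (eps_gt0 : 0 < eps).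
Hypotheses (q_ge1 : 1 <= q) (D_ge1 : 1 <= D) (K_ge0 : 0 <= K).
Hypothesis u_small : 16 * L ^+ 2 * D * u ^+ 2 <= eps.
Hypothesis eta_small : 2 * L * q * D * sigma ^+ 2 * eta <= eps * u ^+ 2.
Hypothesis K_small : 100 * K * eps <= 16 * L ^+ 2 * sigma ^+ 2 * D.

Let variance : R := 5 / 8 * (sigma ^+ 2 / u ^+ 2) + K.

Let L2_gt0 : 0 < L ^+ 2. Proof. by rewrite exprn_gt0. Qed.
Let sigma2_gt0 : 0 < sigma ^+ 2. Proof. by rewrite exprn_gt0. Qed.
Let u2_gt0 : 0 < u ^+ 2. Proof. by rewrite exprn_gt0. Qed.
Let D_gt0 : 0 < D. Proof. exact: lt_le_trans D_ge1. Qed.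
Let q_gt0 : 0 < q. Proof. exact: lt_le_trans q_ge1. Qed.

Let variance_ge0 : 0 <= variance.
Proof. by rewrite addr_ge0// mulr_ge0// divr_ge0// ltW. Qed.

Lemma variance_le : u ^+ 2 * variance <= 127 / 200 * sigma ^+ 2.
Proof.
have K_share : 100 * K * u ^+ 2 <= sigma ^+ 2.
  rewrite -(@ler_pM2l _ (16 * L ^+ 2 * D)) ?mulr_gt0//.
  have := ler_wpM2l (mulr_ge0 (ler0n R 100) K_ge0) u_small; move: K_small; lra.
have -> : u ^+ 2 * variance = 5 / 8 * sigma ^+ 2 + K * u ^+ 2.
  by rewrite /variance; field; rewrite gt_eqF.
by move: K_share; lra.
Qed.

Lemma delay_share : L * eta * variance * D * q <= 127 / 400 * eps.
Proof.
rewrite -(@ler_pM2l _ (2 * sigma ^+ 2)) ?mulr_gt0//.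
have := ler_wpM2r variance_ge0 eta_small.
have := ler_wpM2l (ltW eps_gt0) variance_le; lra.
Qed.

Let stepsize_variance_le : L * eta * variance * D <= 127 / 400 * eps.
Proof.
apply: le_trans _ delay_share; rewrite ler_peMr// !mulr_ge0 ?(ltW L_gt0)//.
  exact: ltW.
exact: ltW.
Qed.

Lemma quadratic_share : L / 2 * eta * (D * variance) <= 127 / 800 * eps.
Proof. by have := stepsize_variance_le; lra. Qed.

Lemma stepsize_le : 32 * L ^+ 3 * sigma ^+ 2 * eta <= eps ^+ 2.
Proof.
have scale_ge0 : 0 <= 2 * L * sigma ^+ 2 * eta by rewrite !mulr_ge0// ltW.
have eta_le : 2 * L * sigma ^+ 2 * eta <= eps * u ^+ 2.
  apply: le_trans eta_small.
  rewrite [leRHS](_ : _ = 2 * L * sigma ^+ 2 * eta * (q * D)); last by ring.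
  by rewrite ler_peMr// mulr_ege1.
have u_le : 16 * L ^+ 2 * u ^+ 2 <= eps.
  apply: le_trans u_small; rewrite [leRHS]mulrAC.
  by rewrite ler_peMr// !mulr_ge0// ltW.
have := ler_wpM2l (mulr_ge0 (ler0n R 16) (ltW L2_gt0)) eta_le.
by have := ler_wpM2l (ltW eps_gt0) u_le; lra.
Qed.

Lemma drift_share (c : R) : 0 <= c ->
  10 ^+ 4 * c ^+ 2 * eps <= 32 * L ^+ 4 * sigma ^+ 2 ->
  c * (eta * Num.sqrt (D * variance)) <= eps / 100.
Proof.
move=> c_ge0 c_small; have Dv_ge0 : 0 <= D * variance by rewrite mulr_ge0// ltW.
rewrite -ler_sqr ?nnegrE ?mulr_ge0 ?sqrtr_ge0 ?(ltW eta_gt0) ?(ltW eps_gt0)//.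
rewrite !exprMn sqr_sqrtr//.
have product_le : (32 * L ^+ 3 * sigma ^+ 2 * eta) * (L * eta * variance * D) <= eps ^+ 3.
  rewrite (exprSr eps) ler_pM// ?stepsize_le//.
  - by rewrite !mulr_ge0 ?exprn_ge0// ltW.
  - by rewrite !mulr_ge0// ltW.
  - by move: stepsize_variance_le eps_gt0; lra.
have scale_gt0 : 0 < 10 ^+ 4 * (32 * L ^+ 4 * sigma ^+ 2).
  by rewrite !mulr_gt0 ?exprn_gt0.
rewrite -(ler_pM2l scale_gt0).
have := ler_wpM2l (mulr_ge0 (exprn_ge0 4 (ler0n R 10)) (sqr_ge0 c)) product_le.
have := ler_wpM2r (sqr_ge0 eps) c_small; lra.
Qed.

Variables (G B n N gap0 : R).
Hypotheses (G_ge0 : 0 <= G) (B_ge0 : 0 <= B) (n_ge0 : 0 <= n) (N_gt0 : 0 < N)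
  (eps_le1 : eps <= 1).
Hypothesis N_large : 6 * Num.max gap0 1 <= eta * eps * N.

Lemma initial_share (rho : R) : 0 <= rho ->
  (gap0 + rho) / eta / N <= eps / 6 + rho.
Proof.
move=> rho_ge0; have [gap_le one_le] : gap0 <= Num.max gap0 1 /\ 1 <= Num.max gap0 1.
  by rewrite !le_max !lexx orbT.
have rho_le : rho <= Num.max gap0 1 * rho by rewrite ler_peMl.
have etaN_gt0 : 0 < eta * N by rewrite mulr_gt0.
have eps_rho : eps * rho <= rho by rewrite ler_piMl.
rewrite ler_pdivrMr// ler_pdivrMr//.
have := ler_wpM2r rho_ge0 N_large; have := ler_wpM2l (ltW etaN_gt0) eps_rho.
have : 0 <= eta * N * rho by rewrite mulr_ge0// ltW.
by move: N_large; lra.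
Qed.

Lemma rate_share :
  10 ^+ 4 * (2 * G * L * (n * B) + G * B) ^+ 2 * eps <= 32 * L ^+ 4 * sigma ^+ 2 ->
  (gap0 + G * (eta * B * Num.sqrt (D * variance))) / eta / N +
  (L / 2 * eta * (D * variance) + 2 * L ^+ 2 * u ^+ 2 * D +
   (L * eta * variance * D * q + 2 * G * L * (n * B) * (eta * Num.sqrt (D * variance)))) <=
  7 / 8 * eps.
Proof.
move=> G_small; set rho := eta * Num.sqrt (D * variance).
have rho_ge0 : 0 <= rho by rewrite mulr_ge0 ?sqrtr_ge0// ltW.
have drift_ge0 : 0 <= 2 * G * L * (n * B) + G * B.
  by rewrite addr_ge0 ?mulr_ge0// ltW.
have := drift_share drift_ge0 G_small; rewrite -/rho.
have := initial_share (mulr_ge0 (mulr_ge0 G_ge0 B_ge0) rho_ge0).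
rewrite (_ : G * (eta * B * _) = G * B * rho); last by rewrite /rho; ring.
have := delay_share; have := quadratic_share; move: u_small eps_gt0.
by move: ((gap0 + _) / eta / N) => initial; lra.
Qed.

End rate.

Section complexity.
Context {R : realType}.
Variables (L sigma eps q D gap gap0 eta N T B : R).
Hypotheses (L_gt0 : 0 < L) (sigma_gt0 : 0 < sigma) (eps_gt0 : 0 < eps) (eps_le1 : eps <= 1).
Hypotheses (q_ge1 : 1 <= q) (D_ge1 : 1 <= D) (gap0_le : gap0 <= gap).
Hypothesis etaE :
  eta = (eps * (eps / (16 * L ^+ 2 * D)) / sigma ^+ 2) / (2 * L * q * D).
Hypotheses (N_ge : 6 / (eta * eps) * Num.max gap0 1 <= N)
  (N_lt : N < 6 / (eta * eps) * Num.max gap0 1 + 1).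
Hypotheses (N_le : N <= T + 1) (T_le : T <= N + B - 1).
Hypotheses (eps_L : eps <= 96 * L ^+ 3 * sigma ^+ 2) (eps_B : eps * (B + 1) <= 1).

Let scale : R := q * D ^+ 2 / eps ^+ 3.

Let D_gt0 : 0 < D. Proof. exact: lt_le_trans D_ge1. Qed.
Let q_gt0 : 0 < q. Proof. exact: lt_le_trans q_ge1. Qed.

Lemma iterations_scale : 6 / (eta * eps) = 192 * L ^+ 3 * sigma ^+ 2 * scale.
Proof. by rewrite etaE /scale; field; rewrite !gt_eqF. Qed.

Lemma invr_eps_le_scale : eps^-1 <= scale.
Proof.
rewrite -[leLHS]mul1r /scale ler_pM ?invr_ge0 ?(ltW eps_gt0)//.
  by rewrite mulr_ege1// exprn_ege1.
rewrite lef_pV2 ?posrE ?exprn_gt0// exprS.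
by rewrite ger_pMr// exprn_ile1// ltW.
Qed.

(* The rounding and the initial delay cost less than one and [1 / eps] iterations. *)
Lemma iterations_theta :
  96 * L ^+ 3 * sigma ^+ 2 * scale <= T /\
  T <= (192 * L ^+ 3 * sigma ^+ 2 * Num.max gap 1 + 1) * scale.
Proof.
pose k := L ^+ 3 * sigma ^+ 2; have k_gt0 : 0 < k by rewrite mulr_gt0// exprn_gt0.
have scale_ge := invr_eps_le_scale.
have scale_gt0 : 0 < scale by apply: lt_le_trans scale_ge; rewrite invr_gt0.
have one_le_max : 1 <= Num.max gap0 1 by rewrite le_max lexx orbT.
have max_le : Num.max gap0 1 <= Num.max gap 1.
  by rewrite ge_max !le_max gap0_le lexx orbT.
have k_scale_ge1 : 1 <= 96 * k * scale.
  apply: (@le_trans _ _ (96 * k * eps^-1)); last by rewrite ler_wpM2l// mulr_ge0// ltW.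
  by rewrite ler_pdivlMr// mul1r /k mulrA.
have B_le : B <= scale.
  apply: le_trans scale_ge; rewrite -[leRHS]mul1r ler_pdivlMr// mulrC.
  by apply: le_trans eps_B; rewrite ler_pM2l// lerDl.
have k_scale_ge0 : 0 <= 192 * k * scale by apply: mulr_ge0 (ltW scale_gt0); rewrite mulr_ge0// ltW.
have := ler_wpM2l k_scale_ge0 one_le_max; have := ler_wpM2l k_scale_ge0 max_le.
move: N_ge N_lt N_le T_le; rewrite iterations_scale /k.
by move: (Num.max _ _) (Num.max _ _) k_scale_ge1 B_le; rewrite /k => ? ?; lra.
Qed.

End complexity.

(** * Stamps and delays *)

Section stamps.
Context {R : realType} {n : nat} {dim : 'I_n -> nat}.
Variables (e : rel 'I_n) (arr : nat -> 'I_n -> 'I_n -> seq nat)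
  (f : 'I_n -> profile R dim -> R) (u eta : R) (x0 : profile R dim).
Hypothesis arr_lt : forall t i k s, s \in arr t i k -> (s < t)%N.
Implicit Types tab : @table R n.

Lemma candidate_ind (Q : R * int -> Prop) tab t i j :
  Q (0, -1) -> (forall s k, (s < t)%N -> Q (tab s k j)) ->
  forall p, p \in candidate_pairs e arr tab t i j -> Q p.
Proof.
move=> Q0 Q_past p /flattenP[pairs /mapP[k _ ->]].
case received : (arr t i k) => [|s l].
  rewrite inE => /eqP ->; case: t Q_past received => //= t Q_past _; exact: Q_past.
by rewrite -received => /mapP[r r_in ->]; apply: Q_past; exact: arr_lt r_in.
Qed.

Lemma eq_candidate_stamps tab tab' t i j :
  (forall s k, (s < t)%N -> (tab s k j).2 = (tab' s k j).2) ->
  [seq p.2 | p <- candidate_pairs e arr tab t i j] =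
  [seq p.2 | p <- candidate_pairs e arr tab' t i j].
Proof.
move=> eq_past; rewrite /candidate_pairs !map_flatten -!map_comp; congr flatten.
apply: eq_map => k /=; case received : (arr t i k) => [|s l].
  by case: t eq_past received => //= t eq_past _; rewrite eq_past.
rewrite -received -!map_comp; apply/eq_in_map => r r_in /=.
by apply: eq_past; exact: arr_lt r_in.
Qed.

Lemma run_pairs z nP nM x tab : zfo_run e arr f u eta x0 z nP nM x tab ->
  forall t i j, (tab t i j).1 =
      at_stamp (observed_difference f u z nP nM x j) (tab t i j).2 /\
    (tab t i j).2 <= t%:Z.
Proof.
move=> run; elim/ltn_ind => t IH i j.
have [->|ij] := eqVneq i j; first by rewrite (run_own run).
have [tab_in _] := run_adopt run t ij.
apply: (candidate_ind (Q := fun p => p.1 =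
  at_stamp (observed_difference f u z nP nM x j) p.2 /\ p.2 <= t%:Z) _ _ tab_in) => //.
by move=> s k st; have [-> le] := IH s st k j; split => //; lia.
Qed.

(* Adoption compares stamps only, so the stamps do not depend on the randomness. *)
Lemma run_stamps z nP nM x tab z' nP' nM' x' tab' :
  zfo_run e arr f u eta x0 z nP nM x tab ->
  zfo_run e arr f u eta x0 z' nP' nM' x' tab' ->
  forall t i j, (tab t i j).2 = (tab' t i j).2.
Proof.
move=> run run'; elim/ltn_ind => t IH i j.
have [->|ij] := eqVneq i j; first by rewrite (run_own run) (run_own run').
have [tab_in tab_max] := run_adopt run t ij.
have [tab'_in tab'_max] := run_adopt run' t ij.
have stampsE : [seq p.2 | p <- candidate_pairs e arr tab t i j] =
    [seq p.2 | p <- candidate_pairs e arr tab' t i j].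
  by apply: eq_candidate_stamps => s k st; exact: IH.
apply/eqP; rewrite eq_le; apply/andP; split.
  by have := map_f snd tab_in; rewrite stampsE => /mapP[p p_in ->]; exact: tab'_max.
by have := map_f snd tab'_in; rewrite -stampsE => /mapP[p p_in ->]; exact: tab_max.
Qed.

End stamps.

Section delays.
Context {R : realType} {n : nat} (e : rel 'I_n) (Delta : nat).

Lemma gdist_gt0 i j : i != j -> (0 < gdist e i j)%N.
Proof.
move=> ij; rewrite lt0n; apply/eqP => dist0.
have n_gt0 : (0 < n)%N := leq_ltn_trans (leq0n i) (ltn_ord i).
pose reach k := [exists p : k.-tuple 'I_n, path e i p && (last i p == j)].
have found : has reach (iota 0 n) by rewrite has_find size_iota -/(gdist e i j) dist0.
have := nth_find 0%N found; rewrite -/(gdist e i j) dist0 nth_iota//= add0n.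
by move=> /existsP[p]; rewrite (tuple0 p) /= (negPf ij).
Qed.

Lemma delay_le_max i j : (gdist e i j + Delta <= max_delay e Delta)%N.
Proof.
rewrite leq_add2r; apply: leq_trans (leq_bigmax i).
exact: (leq_bigmax (F := fun j => gdist e i j) j).
Qed.

Definition sum_sqr_delay : nat := \sum_i \sum_j (gdist e i j + Delta) ^ 2.

Lemma avg_delayE :
  avg_delay R e Delta = Num.sqrt (sum_sqr_delay%:R / n%:R ^+ 2).
Proof.
rewrite /avg_delay /sum_sqr_delay natr_sum; congr (Num.sqrt (_ / _)).
apply: eq_bigr => i _; rewrite natr_sum; apply: eq_bigr => j _.
by rewrite natrX.
Qed.

Lemma sum_sqr_delay_ge : (0 < sum_sqr_delay)%N -> (n <= sum_sqr_delay)%N.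
Proof.
have [n_le1|n_gt1] := leqP n 1; first exact: leq_trans.
move=> _; rewrite -[leqLHS]card_ord -sum1_card; apply: leq_sum => i _.
have /card_gt0P[j] : (0 < #|predC1 i|)%N by rewrite cardC1 card_ord; lia.
rewrite inE eq_sym => ij; rewrite (bigD1 j)//= ltn_addr// expn_gt0.
by rewrite addn_gt0 gdist_gt0.
Qed.

Lemma avg_delay_sqrt_ge1 : 0 < avg_delay R e Delta ->
  1 <= avg_delay R e Delta * Num.sqrt n%:R.
Proof.
rewrite avg_delayE sqrtr_gt0 => ratio_gt0.
have n_gt0 : 0 < n%:R :> R.
  rewrite lt0r ler0n andbT; apply: contraL ratio_gt0 => /eqP ->.
  by rewrite expr0n invr0 mulr0 ltxx.
have sum_gt0 : (0 < sum_sqr_delay)%N.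
  by move: ratio_gt0; rewrite pmulr_lgt0 ?ltr0n// invr_gt0 exprn_gt0.
rewrite -sqrtrM ?(ltW ratio_gt0)// -[leLHS]sqrtr1 ler_wsqrtr//.
rewrite [leRHS](_ : _ = sum_sqr_delay%:R / n%:R); last by field; rewrite gt_eqF.
by rewrite ler_pdivlMr// mul1r ler_nat sum_sqr_delay_ge.
Qed.

End delays.

(** * Parameters *)

Section parameters.
Context {R : realType}.

Lemma denominator_gt0 (a b : R) : 0 <= a -> 0 < a / b -> 0 < b.
Proof.
move=> a_ge0; apply: contraLR; rewrite -!leNgt => b_le0.
by rewrite mulr_ge0_le0// invr_le0.
Qed.

Lemma radius_dimensions_gt0 (eps L u : R) (D : nat) : 0 < u ->
  u <= Num.sqrt eps / (4 * L * Num.sqrt D%:R) -> 0 < L /\ (0 < D)%N.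
Proof.
move=> u_gt0 /(lt_le_trans u_gt0) /denominator_gt0 - /(_ (sqrtr_ge0 _)).
case: D => [|D]; first by rewrite sqrtr0 mulr0 ltxx.
by rewrite pmulr_lgt0 ?sqrtr_gt0 ?ltr0n// pmulr_rgt0.
Qed.

Lemma stepsize_dimensions_gt0 (eps u sigma L bbar eta : R) (n D : nat) :
  0 < eps -> 0 <= bbar -> 0 < eta ->
  eta <= (eps * u ^+ 2 / sigma ^+ 2) / (2 * L * bbar * Num.sqrt n%:R * D%:R) ->
  0 < bbar /\ (0 < n)%N.
Proof.
move=> /ltW eps_ge0 bbar_ge0 eta_gt0 /(lt_le_trans eta_gt0).
have ratio_ge0 : 0 <= eps * u ^+ 2 / sigma ^+ 2.
  by rewrite divr_ge0 ?sqr_ge0// mulr_ge0 ?sqr_ge0.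
move=> /(denominator_gt0 ratio_ge0).
case: n => [|n]; first by rewrite sqrtr0 mulr0 mul0r ltxx.
have [->|bbar_neq0] := eqVneq bbar 0; first by rewrite mulr0 !mul0r ltxx.
by move=> _; split=> //; rewrite lt_def bbar_neq0.
Qed.

Lemma sqr_radius_bound (eps L : R) (D : nat) : 0 <= eps ->
  (Num.sqrt eps / (4 * L * Num.sqrt D%:R)) ^+ 2 = eps / (16 * L ^+ 2 * D%:R).
Proof.
move=> eps_ge0; rewrite expr_div_n sqr_sqrtr// !exprMn sqr_sqrtr//.
by congr (_ / (_ * _ * _)); ring.
Qed.

Lemma sqr_radius_le (eps L u : R) (D : nat) : 0 < eps -> 0 < u ->
  u <= Num.sqrt eps / (4 * L * Num.sqrt D%:R) ->
  16 * L ^+ 2 * D%:R * u ^+ 2 <= eps.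
Proof.
move=> eps_gt0 u_gt0 u_le; have [L_gt0 D_gt0] := radius_dimensions_gt0 u_gt0 u_le.
rewrite mulrC -ler_pdivlMr; last by rewrite !mulr_gt0 ?exprn_gt0 ?ltr0n.
rewrite -(sqr_radius_bound L D (ltW eps_gt0)) ler_sqr ?nnegrE ?(ltW u_gt0)//.
exact: ltW (lt_le_trans u_gt0 u_le).
Qed.

Definition drift_constant (G L : R) (n B : nat) : R :=
  2 * G * L * (n%:R * B%:R) + G * B%:R.

(* The first two quotients keep the cost part of the second moment below one
   hundredth of [sigma^2 / u^2] and the drift below [eps / 100]; the last two bounds
   absorb the rounding and the initial delay in [T]. *)
Definition accuracy_threshold (G L sigma : R) (n D B : nat) : R :=
  Num.min 1
    (Num.min (16 * L ^+ 2 * sigma ^+ 2 / (100 * (15 * G ^+ 2 * D%:R) + 1))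
      (Num.min (32 * L ^+ 4 * sigma ^+ 2 / (10 ^+ 4 * drift_constant G L n B ^+ 2 + 1))
        (Num.min (96 * L ^+ 3 * sigma ^+ 2) (B%:R + 1)^-1))).

Let cost_scale_ge0 (G : R) (D : nat) : 0 <= 100 * (15 * G ^+ 2 * D%:R).
Proof. by rewrite mulr_ge0// mulr_ge0// mulr_ge0// sqr_ge0. Qed.

Let drift_scale_ge0 (G L : R) (n B : nat) : 0 <= 10 ^+ 4 * drift_constant G L n B ^+ 2.
Proof. by rewrite mulr_ge0 ?sqr_ge0// exprn_ge0. Qed.

Lemma accuracy_threshold_gt0 (G L sigma : R) (n D B : nat) :
  0 < L -> 0 < sigma -> 0 < accuracy_threshold G L sigma n D B.
Proof.
move=> L_gt0 sigma_gt0; rewrite !lt_min ltr01 invr_gt0 !divr_gt0 ?ltr_wpDl//.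
all: by rewrite ?cost_scale_ge0 ?drift_scale_ge0// !mulr_gt0// exprn_gt0.
Qed.

Lemma accuracy_thresholdP (G L sigma eps : R) (n D B : nat) :
  0 < eps -> (0 < D)%N -> eps <= accuracy_threshold G L sigma n D B ->
  [/\ eps <= 1, 100 * (15 * G ^+ 2 * D%:R) * eps <= 16 * L ^+ 2 * sigma ^+ 2 * D%:R,
      10 ^+ 4 * drift_constant G L n B ^+ 2 * eps <= 32 * L ^+ 4 * sigma ^+ 2,
      eps <= 96 * L ^+ 3 * sigma ^+ 2 & eps * (B%:R + 1) <= 1].
Proof.
move=> eps_gt0 D_gt0; rewrite !le_min => /and5P[eps_le1 cost_le drift_le L_le B_le].
have clear_quotient (a b : R) : 0 <= a -> eps <= b / (a + 1) -> a * eps <= b.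
  by move=> a_ge0; rewrite ler_pdivlMr ?ltr_wpDl//; move: eps_gt0; lra.
split=> //.
- apply: le_trans (clear_quotient _ _ (cost_scale_ge0 G D) cost_le) _.
  by rewrite ler_peMr ?ler1n// mulr_ge0 ?sqr_ge0// mulr_ge0 ?sqr_ge0.
- exact: clear_quotient (drift_scale_ge0 G L n B) drift_le.
- by rewrite -ler_pdivlMr ?ltr_wpDl// mul1r.
Qed.

End parameters.

(** * Convergence *)

Section convergence.
Context {d : measure_display} {Omega : measurableType d} {R : realType}
  {P : probability Omega R} {n : nat} {dim : 'I_n -> nat}.
Variables (G L sigma u eta : R) (f : 'I_n -> profile R dim -> R) (x0 : profile R dim).
Hypotheses (fP : problem G L f) (n_gt0 : (0 < n)%N) (D_gt0 : (0 < \sum_i dim i)%N)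
  (L_gt0 : 0 < L) (u_gt0 : 0 < u) (eta_gt0 : 0 < eta).
Variables (e : rel 'I_n) (Delta : nat) (arr : nat -> 'I_n -> 'I_n -> seq nat).
Variables (z : forall i : 'I_n, nat -> 'I_(dim i) -> {RV P >-> R})
  (noiseP noiseM : 'I_n -> nat -> {RV P >-> R})
  (x : Omega -> nat -> profile R dim) (tab : Omega -> @table R n).
Hypothesis rand : zfo_randomness z noiseP noiseM sigma.
Hypothesis arr_lt : forall t i k s, s \in arr t i k -> (s < t)%N.
Hypothesis run : forall w, zfo_run e arr f u eta x0 (perturbation z w)
  (fun i t => noiseP i t w) (fun i t => noiseM i t w) (x w) (tab w).
Hypothesis delay : forall w t i j,
  t%:Z - (tab w t i j).2 <= (gdist e i j + Delta)%N%:Z.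
Local Notation D := (\sum_i dim i)%N.
Local Notation F := (objective f).
Local Notation B := (max_delay e Delta).
Local Notation variance := (two_point_variance D G sigma u).

Lemma lipschitz_constant_ge0 : 0 <= G.
Proof.
have := cost_lipschitz fP (Ordinal n_gt0) (delta_mx ord0 (Ordinal D_gt0)) 0.
by rewrite subr0 norm2_delta mulr1; apply: le_trans.
Qed.

Let tau t i j : int := (tab point t i j).2.

Let iterate t w : profile R dim := x w t.

Lemma stamps_deterministic w t i j : (tab w t i j).2 = tau t i j.
Proof. exact: (run_stamps arr_lt (run w) (run point)). Qed.

Lemma stamp_le t i j : tau t i j <= t%:Z.
Proof. by have [] := run_pairs arr_lt (run point) t i j. Qed.

Lemma stamp_recent t i j : (B <= t)%N ->
  exists2 s : nat, tau t i j = s%:Z & (t - s <= gdist e i j + Delta)%N.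
Proof.
move=> Bt; have := delay point t i j; have := delay_le_max e Delta i j.
rewrite -/(tau t i j); case: (tau t i j) => s dist_le delay_le.
  by exists s => //; lia.
by exfalso; lia.
Qed.

Lemma perturbation_stack w t : stack (perturbation z w) t =
  xi_row (primitive_variable z noiseP noiseM) (coords t) w.
Proof. by apply/rowP => k; rewrite !mxE. Qed.

Lemma iterate_step t w : iterate t.+1 w =
  iterate t w - eta *: estimate u f z noiseP noiseM iterate tau t w.
Proof.
rewrite /iterate (run_step (run w)); congr (_ - _ *: _).
apply/rowP => k; rewrite [LHS]mxE [RHS]mxE /local_estimate [LHS]mxE; congr (_ * _).
rewrite summxE; apply: eq_bigr => j _; rewrite [LHS]mxE.
have [-> _] := run_pairs arr_lt (run w) t (tagnat.sig1 k) j.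
rewrite stamps_deterministic /stamped_sample.
case: (tau t _ j) => s /=; last by rewrite mul0r.
by rewrite /observed_difference perturbation_stack; congr (_ * _); rewrite mxE.
Qed.

Lemma expectation_sqr_gradient t :
  ('E_P[fun w => (norm2 (gradient F (x w t)) ^+ 2)%R] =
   (expect P (fun w => norm2 (gradient F (iterate t w)) ^+ 2))%:E)%E.
Proof.
have igrad := sqr_gradient_integrable fP lipschitz_constant_ge0 (ltW L_gt0) stamp_le
  (fun w => run_init (run w)) iterate_step t.
by rewrite expectation.unlock (EFin_expect igrad).
Qed.

Lemma sum_sqr_gradient_le (T : nat) : (B <= T)%N ->
  7 / 8 * \sum_(B <= t < T.+1) expect P (fun w => norm2 (gradient F (iterate t w)) ^+ 2) <=
  (F x0 - infimum F + G * (eta * B%:R * Num.sqrt (D%:R * variance))) / eta +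
  (T - B + 1)%:R *
    (L / 2 * eta * (D%:R * variance) + 2 * L ^+ 2 * u ^+ 2 * D%:R +
     (L * eta * variance * D%:R * (avg_delay R e Delta * Num.sqrt n%:R) +
      2 * G * L * (n%:R * B%:R) * (eta * Num.sqrt (D%:R * variance)))).
Proof.
move=> BT; have G_ge0 := lipschitz_constant_ge0; have L_ge0 := ltW L_gt0.
apply: le_trans (telescoped_descent fP n_gt0 G_ge0 L_ge0 u_gt0 eta_gt0 rand stamp_le
  (fun w => run_init (run w)) iterate_step BT stamp_recent) _.
rewrite lerD2l ler_wpM2l// lerD2l.
exact: (delay_error_le sigma u n_gt0 G_ge0 L_ge0 eta_gt0 (delay_le_max e Delta)).
Qed.

Variables (eps : R) (T : nat).
Hypotheses (sigma_gt0 : 0 < sigma) (eps_gt0 : 0 < eps) (BT : (B <= T)%N).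
Hypothesis eps_small : eps <= accuracy_threshold G L sigma n D B.
Hypothesis u_le : u <= Num.sqrt eps / (4 * L * Num.sqrt D%:R).
Hypothesis eta_le : eta <= (eps * u ^+ 2 / sigma ^+ 2) /
  (2 * L * avg_delay R e Delta * Num.sqrt n%:R * D%:R).
Hypothesis T_ge :
  Num.ceil (6 / (eta * eps) * Num.max (F x0 - infimum F) 1) <= (T - B + 1)%N%:Z.

Lemma mean_sqr_gradient_le : (((T - B + 1)%:R^-1)%:E *
    \sum_(B <= t < T.+1) 'E_P[fun w => (norm2 (gradient F (x w t)) ^+ 2)%R] <= eps%:E)%E.
Proof.
rewrite (eq_bigr _ (fun t _ => expectation_sqr_gradient t)).
have := T_ge; set N := (T - B + 1)%N => N_ge.
have N_gt0 : 0 < N%:R :> R by rewrite ltr0n /N addn1.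
have [bbar_gt0 _] := stepsize_dimensions_gt0 eps_gt0 (sqrtr_ge0 _) eta_gt0 eta_le.
have D_ge1 : 1 <= D%:R :> R by rewrite ler1n.
have [eps_le1 cost_le drift_le _ _] := accuracy_thresholdP eps_gt0 D_gt0 eps_small.
have eta_scaled : 2 * L * (avg_delay R e Delta * Num.sqrt n%:R) * D%:R * sigma ^+ 2 * eta
    <= eps * u ^+ 2.
  move: eta_le; rewrite ler_pdivlMr; last first.
    by rewrite mulr_gt0 ?ltr0n// mulr_gt0 ?sqrtr_gt0 ?ltr0n// !mulr_gt0.
  by rewrite ler_pdivlMr ?exprn_gt0//; lra.
have N_large : 6 * Num.max (F x0 - infimum F) 1 <= eta * eps * N%:R.
  move: N_ge; rewrite ceil_le_int -pmulrn mulrAC ler_pdivrMr ?mulr_gt0//.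
  by rewrite (mulrC N%:R).
have K_ge0 : 0 <= 15 * G ^+ 2 * D%:R by rewrite mulr_ge0// mulr_ge0// sqr_ge0.
have := rate_share L_gt0 sigma_gt0 u_gt0 eta_gt0 eps_gt0 (avg_delay_sqrt_ge1 bbar_gt0) D_ge1
  K_ge0 (sqr_radius_le eps_gt0 u_gt0 u_le) eta_scaled cost_le lipschitz_constant_ge0
  (ler0n R B) (ler0n R n) N_gt0 eps_le1 N_large drift_le.
rewrite sumEFin -EFinM lee_fin ler_pdivrMl// => /(ler_wpM2l (ltW N_gt0)).
rewrite [leLHS]mulrDr mulrCA divff ?gt_eqF// mulr1.
by move=> /(le_trans (sum_sqr_gradient_le BT)); lra.
Qed.

End convergence.

Lemma zfo_iterations_theta (R : realType) (G L sigma eps u eta gap gap0 : R) (n D T : nat)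
    (e : rel 'I_n) (Delta : nat) :
  let bbar := avg_delay R e Delta in
  let B := max_delay e Delta in
  0 < sigma -> 0 < eps -> 0 < u -> 0 < eta -> (B <= T)%N ->
  eps <= accuracy_threshold G L sigma n D B -> gap0 <= gap ->
  u = Num.sqrt eps / (4 * L * Num.sqrt D%:R) ->
  eta = (eps * u ^+ 2 / sigma ^+ 2) / (2 * L * bbar * Num.sqrt n%:R * D%:R) ->
  (T - B + 1)%N%:Z = Num.ceil (6 / (eta * eps) * Num.max gap0 1) ->
  96 * L ^+ 3 * sigma ^+ 2 * (bbar * Num.sqrt n%:R * D%:R ^+ 2 / eps ^+ 3) <= T%:R /\
  T%:R <= (192 * L ^+ 3 * sigma ^+ 2 * Num.max gap 1 + 1) *
    (bbar * Num.sqrt n%:R * D%:R ^+ 2 / eps ^+ 3).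
Proof.
move=> bbar B sigma_gt0 eps_gt0 u_gt0 eta_gt0 BT eps_small gap_le uE etaE TE.
have [u_le eta_le] : u <= Num.sqrt eps / (4 * L * Num.sqrt D%:R) /\
    eta <= (eps * u ^+ 2 / sigma ^+ 2) / (2 * L * bbar * Num.sqrt n%:R * D%:R).
  by rewrite -uE -etaE.
have [L_gt0 D_gt0] := radius_dimensions_gt0 u_gt0 u_le.
have [bbar_gt0 n_gt0] := stepsize_dimensions_gt0 eps_gt0 (sqrtr_ge0 _) eta_gt0 eta_le.
have [eps_le1 _ _ eps_L eps_B] := accuracy_thresholdP eps_gt0 D_gt0 eps_small.
apply: (@iterations_theta R L sigma eps (bbar * Num.sqrt n%:R) D%:R gap gap0 eta
  (T - B + 1)%:R T%:R B%:R) => //.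
- exact: avg_delay_sqrt_ge1.
- by rewrite ler1n.
- by rewrite etaE uE (sqr_radius_bound L D (ltW eps_gt0)) !mulrA.
- by apply: le_trans (ceil_ge _) _; rewrite -TE -pmulrn.
- by have := ceilB1_lt (6 / (eta * eps) * Num.max gap0 1);
    rewrite -TE rmorphB /= -pmulrn ltrBlDr.
- by rewrite natr1 ler_nat addn1 ltnS leq_subr.
- by rewrite lerBrDr natr1 -natrD ler_nat addnAC subnK// addn1.
Qed.

Theorem theorem4 (R : realType) (G L sigma gap : R) (sigma_gt0 : 0 < sigma) :
  exists c C : R, [/\ 0 < c, 0 < C &
  forall (n : nat) (dim : 'I_n -> nat) (e : rel 'I_n) (Delta : nat),
    connected_graph e ->
  let d := (\sum_i dim i)%N in
  let bbar := avg_delay R e Delta in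
  let B := max_delay e Delta in
  exists eps0 : R, 0 < eps0 /\
  forall eps : R, 0 < eps -> eps <= eps0 ->
  forall (f : 'I_n -> profile R dim -> R) (x0 : profile R dim),
    problem G L f ->
  let F := objective f in
  let gap0 := F x0 - infimum F in
  forall (u eta : R) (T : nat), 0 < u -> 0 < eta -> (B <= T)%N ->
    (u <= Num.sqrt eps / (4 * L * Num.sqrt d%:R) ->
     eta <= (eps * u ^+ 2 / sigma ^+ 2) / (2 * L * bbar * Num.sqrt n%:R * d%:R) ->
     Num.ceil (6 / (eta * eps) * Num.max gap0 1) <= (T - B + 1)%N%:Z ->
     forall (disp : measure_display) (Omega : measurableType disp)
       (P : probability Omega R)
       (z : forall i : 'I_n, nat -> 'I_(dim i) -> {RV P >-> R})
       (noiseP noiseM : 'I_n -> nat -> {RV P >-> R})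
       (arr : nat -> 'I_n -> 'I_n -> seq nat)
       (x : Omega -> nat -> profile R dim) (tab : Omega -> table),
       zfo_randomness z noiseP noiseM sigma ->
       (forall t i k s, s \in arr t i k -> (s < t)%N) ->
       (forall w, zfo_run e arr f u eta x0 (perturbation z w)
          (fun i t => noiseP i t w) (fun i t => noiseM i t w) (x w) (tab w)) ->
       (forall w t i j, t%:Z - (tab w t i j).2 <= (gdist e i j + Delta)%N%:Z) ->
       (((T - B + 1)%:R^-1)%:E *
          \sum_(B <= t < T.+1) 'E_P[fun w => (norm2 (gradient F (x w t)) ^+ 2)%R]
        <= eps%:E)%E)
    /\
    (gap0 <= gap ->
     u = Num.sqrt eps / (4 * L * Num.sqrt d%:R) ->
     eta = (eps * u ^+ 2 / sigma ^+ 2) / (2 * L * bbar * Num.sqrt n%:R * d%:R) ->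
     (T - B + 1)%N%:Z = Num.ceil (6 / (eta * eps) * Num.max gap0 1) ->
     c * (bbar * Num.sqrt n%:R * d%:R ^+ 2 / eps ^+ 3) <= T%:R /\
     T%:R <= C * (bbar * Num.sqrt n%:R * d%:R ^+ 2 / eps ^+ 3))].
Proof.
have [L_gt0|L_le0] := ltP 0 L; last first.
  exists 1, 1; split => // n dim e Delta _ d bbar B; exists 1; split => //.
  move=> eps _ _ f x0 _ F gap0 u eta T u_gt0 _ _.
  have no_radius : ~ u <= Num.sqrt eps / (4 * L * Num.sqrt d%:R).
    by move=> /(radius_dimensions_gt0 u_gt0) []; rewrite ltNge L_le0.
  by split=> [/no_radius//|_ uE]; case: no_radius; rewrite -uE.
have coef_gt0 : 0 < 96 * L ^+ 3 * sigma ^+ 2 by rewrite !mulr_gt0 ?exprn_gt0.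
exists (96 * L ^+ 3 * sigma ^+ 2), (192 * L ^+ 3 * sigma ^+ 2 * Num.max gap 1 + 1).
split=> // [|n dim e Delta _ d bbar B].
  by rewrite ltr_wpDl// mulr_ge0 ?le_max ?ler01 ?orbT//; move: coef_gt0; lra.
exists (accuracy_threshold G L sigma n d B); split; first exact: accuracy_threshold_gt0.
move=> eps eps_gt0 eps_small f x0 fP F gap0 u eta T u_gt0 eta_gt0 BT; split.
  move=> u_le eta_le T_ge disp Omega P z noiseP noiseM arr x tab rand arr_lt run delay.
  have [_ d_gt0] := radius_dimensions_gt0 u_gt0 u_le.
  have [_ n_gt0] := stepsize_dimensions_gt0 eps_gt0 (sqrtr_ge0 _) eta_gt0 eta_le.
  exact: (mean_sqr_gradient_le fP n_gt0 d_gt0 L_gt0 u_gt0 eta_gt0 rand arr_lt run delay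
    sigma_gt0 eps_gt0 BT eps_small u_le eta_le T_ge).
move=> gap_le uE etaE TE.
exact: zfo_iterations_theta sigma_gt0 eps_gt0 u_gt0 eta_gt0 BT eps_small gap_le uE etaE TE.
Qed.
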